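(* Let $\mathcal C$ be a ribbon monoidal category with coequalizers, with braiding $c$ and twist $\theta$. Suppose that $(A,\mu,\eta)$ is a commutative algebra in $\mathcal C$ such that $\mathcal C_A^{\mathrm{loc}}$ is rigid, and suppose moreover that $\theta_A=\mathrm{id}_A$ (so that the right $A$-module $D(A)=A^*$ belongs to $\mathcal C_A^{\mathrm{loc}}$). Then the following are equivalent: (a) $\mathcal C_A^{\mathrm{loc}}$ is a ribbon monoidal category with the twist $\theta$. (b) $D(A)$ belongs to the Müger center of $\mathcal C_A^{\mathrm{loc}}$.
   Context: A twist on a braided category is a natural isomorphism $\theta:\mathrm{id}\Rightarrow\mathrm{id}$ with $\theta_{X\otimes Y}=(\theta_X\otimes\theta_Y)c_{Y,X}c_{X,Y}$; on a rigid braided category it is a ribbon structure if $(\theta_X)^*=\theta_{X^*}$ for all $X$ (left duals). A ribbon category is a rigid braided category with a ribbon structure. An algebra $(A,\mu,\eta)$ is commutative if $\mu c_{A,A}=\mu$. $\mathcal C_A$ is the category of right $A$-modules $(M,a_M^r)$, monoidal under the tensor product over $A$ (a coequalizer) with unit $A$, where $M$ has left action $a_M^r c_{A,M}$. $M$ is local if $a_M^r c_{A,M}c_{M,A}=a_M^r$. $\mathcal C_A^{\mathrm{loc}}$ is the full monoidal subcategory of local modules; it is braided with braiding $c^A$ induced by $c$. When $\theta_A=\mathrm{id}_A$, $\theta$ restricts to a twist on $\mathcal C_A^{\mathrm{loc}}$ (given on $M$ by $\theta_M$). $D(A)$ is the object $A^*$ with right action $(\mathrm{id}_{A^*}\otimes\mathrm{ev}_A)\circ(\mu^*\otimes\mathrm{id}_A):A^*\otimes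 A\to A^*$, identifying $(A\otimes A)^*=A^*\otimes A^*$. The Müger center of a braided category $\mathcal D$ with braiding $c$ is $\{X\in\mathcal D:c_{Y,X}c_{X,Y}=\mathrm{id}\ \forall\,Y\in\mathcal D\}$. *)

(* Defs.v *)
From mathcomp Require Import ssreflect ssrfun.
From Stdlib Require Import ProofIrrelevance.

Set Implicit Arguments.
Unset Strict Implicit.
Unset Printing Implicit Defensive.

Declare Scope cat_scope.
Delimit Scope cat_scope with C.
Local Open Scope cat_scope.

Record category := Category {
  obj :> Type;
  hom : obj -> obj -> Type;
  idm : forall X, hom X X;
  comp : forall X Y Z, hom Y Z -> hom X Y -> hom X Z;
  comp1m : forall X Y (f : hom X Y), comp (idm Y) f = f;
  compm1 : forall X Y (f : hom X Y), comp f (idm X) = f;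
  compA : forall X Y Z W (f : hom Z W) (g : hom Y Z) (h : hom X Y),
    comp (comp f g) h = comp f (comp g h)
}.

Arguments idm {c} X.
Arguments comp {c X Y Z} f g.

Notation "f ∘ g" := (comp f g) (at level 41, right associativity) : cat_scope.

Record monoidal := Monoidal {
  mcat :> category;
  ten : mcat -> mcat -> mcat;
  one : mcat;
  tenm : forall X X' Y Y' : mcat,
    hom X X' -> hom Y Y' -> hom (ten X Y) (ten X' Y');
  tenm_id : forall X Y : mcat, tenm (idm X) (idm Y) = idm (ten X Y);
  tenm_comp : forall (X X' X'' Y Y' Y'' : mcat) (f' : hom X' X'')
      (f : hom X X') (g' : hom Y' Y'') (g : hom Y Y'),
    tenm (f' ∘ f) (g' ∘ g) = tenm f' g' ∘ tenm f g;
  asc : forall X Y Z, hom (ten (ten X Y) Z) (ten X (ten Y Z));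
  asci : forall X Y Z, hom (ten X (ten Y Z)) (ten (ten X Y) Z);
  ascK : forall X Y Z, asci X Y Z ∘ asc X Y Z = idm _;
  asciK : forall X Y Z, asc X Y Z ∘ asci X Y Z = idm _;
  asc_nat : forall (X X' Y Y' Z Z' : mcat) (f : hom X X') (g : hom Y Y')
      (h : hom Z Z'),
    asc X' Y' Z' ∘ tenm (tenm f g) h = tenm f (tenm g h) ∘ asc X Y Z;
  lu : forall X, hom (ten one X) X;
  lui : forall X, hom X (ten one X);
  luK : forall X, lui X ∘ lu X = idm _;
  luiK : forall X, lu X ∘ lui X = idm _;
  lu_nat : forall (X Y : mcat) (f : hom X Y),
    lu Y ∘ tenm (idm one) f = f ∘ lu X;
  ru : forall X, hom (ten X one) X;
  rui : forall X, hom X (ten X one);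
  ruK : forall X, rui X ∘ ru X = idm _;
  ruiK : forall X, ru X ∘ rui X = idm _;
  ru_nat : forall (X Y : mcat) (f : hom X Y),
    ru Y ∘ tenm f (idm one) = f ∘ ru X;
  pentagon : forall X Y Z W,
    asc X Y (ten Z W) ∘ asc (ten X Y) Z W =
    tenm (idm X) (asc Y Z W) ∘ asc X (ten Y Z) W ∘ tenm (asc X Y Z) (idm W);
  triangle : forall X Y,
    tenm (idm X) (lu Y) ∘ asc X one Y = tenm (ru X) (idm Y)
}.

Arguments ten {m} X Y.
Arguments one {m}.
Arguments tenm {m X X' Y Y'} f g.
Arguments asc {m} X Y Z.
Arguments asci {m} X Y Z.
Arguments lu {m} X.
Arguments lui {m} X.
Arguments ru {m} X.
Arguments rui {m} X.

Notation "X ⊗ Y" := (ten X Y) (at level 35, right associativity) : cat_scope.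
Notation "f ⊠ g" := (tenm f g) (at level 35, no associativity) : cat_scope.
Notation "f ▷ W" := (tenm f (idm W)) (at level 34, left associativity) : cat_scope.
Notation "X ◁ f" := (tenm (idm X) f) (at level 33, right associativity) : cat_scope.

(* br X Y is the braiding c_{X,Y} : X ⊗ Y -> Y ⊗ X. *)
Record braided := Braided {
  bmon :> monoidal;
  br : forall X Y : bmon, hom (X ⊗ Y) (Y ⊗ X);
  bri : forall X Y : bmon, hom (Y ⊗ X) (X ⊗ Y);
  brK : forall X Y, bri X Y ∘ br X Y = idm _;
  briK : forall X Y, br X Y ∘ bri X Y = idm _;
  br_nat : forall (X X' Y Y' : bmon) (f : hom X X') (g : hom Y Y'),
    br X' Y' ∘ (f ⊠ g) = (g ⊠ f) ∘ br X Y;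
  hexagon1 : forall X Y Z : bmon,
    asc Y Z X ∘ br X (Y ⊗ Z) ∘ asc X Y Z =
    (Y ◁ br X Z) ∘ asc Y X Z ∘ (br X Y ▷ Z);
  hexagon2 : forall X Y Z : bmon,
    asci Z X Y ∘ br (X ⊗ Y) Z ∘ asci X Y Z =
    (br X Z ▷ Y) ∘ asci X Z Y ∘ (X ◁ br Y Z)
}.

Arguments br {b} X Y.
Arguments bri {b} X Y.

Section Duality.
Variable C : monoidal.

Definition zigzag1 (D X : C) (ev : hom (D ⊗ X) one) (coev : hom one (X ⊗ D)) :=
  ru X ∘ (X ◁ ev) ∘ asc X D X ∘ (coev ▷ X) ∘ lui X = idm X.

Definition zigzag2 (D X : C) (ev : hom (D ⊗ X) one) (coev : hom one (X ⊗ D)) :=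
  lu D ∘ (ev ▷ D) ∘ asci D X D ∘ (D ◁ coev) ∘ rui D = idm D.

Record leftDual (X : C) := LeftDual {
  ldual :> C;
  ev : hom (ldual ⊗ X) one;
  coev : hom one (X ⊗ ldual);
  ldual_zz1 : zigzag1 ev coev;
  ldual_zz2 : zigzag2 ev coev
}.

Record rightDual (X : C) := RightDual {
  rdual : C;
  rev : hom (X ⊗ rdual) one;
  rcoev : hom one (rdual ⊗ X);
  rdual_zz1 : zigzag1 rev rcoev;
  rdual_zz2 : zigzag2 rev rcoev
}.

(* The duals are chosen; transposes and D(A) below refer to this choice. *)
Record rigid := Rigid {
  ld : forall X : C, leftDual X;
  rd : forall X : C, rightDual X
}.

(* The transpose f^* : Y^* -> X^* of f : X -> Y. *)
Definition dualm (X Y : C) (DX : leftDual X) (DY : leftDual Y) (f : hom X Y) :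
    hom DY DX :=
  lu DX ∘ (ev DY ▷ DX) ∘ asci DY Y DX ∘ (DY ◁ (f ▷ DX)) ∘ (DY ◁ coev DX) ∘ rui DY.

End Duality.

Arguments ldual {C X} l.
Arguments ev {C X} l.
Arguments coev {C X} l.

Record twist (C : braided) := Twist {
  tw :> forall X : C, hom X X;
  twi : forall X : C, hom X X;
  twK : forall X, twi X ∘ tw X = idm X;
  twiK : forall X, tw X ∘ twi X = idm X;
  tw_nat : forall (X Y : C) (f : hom X Y), tw Y ∘ f = f ∘ tw X;
  tw_ten : forall X Y : C,
    tw (X ⊗ Y) = (tw X ⊠ tw Y) ∘ br Y X ∘ br X Y
}.

Definition is_ribbon (C : braided) (R : rigid C) (th : twist C) :=
  forall X : C, dualm (ld R X) (ld R X) (th X) = th (ld R X).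

Record ribbon := Ribbon {
  rbr :> braided;
  rrig : rigid rbr;
  rtw : twist rbr;
  rribbon : is_ribbon rrig rtw
}.

Definition Mueger_center (C : braided) (X : C) :=
  forall Y : C, br Y X ∘ br X Y = idm (X ⊗ Y).

Record coequalizer (C : category) (X Y : C) (f g : hom X Y) := Coequalizer {
  cq_ob : C;
  cq : hom Y cq_ob;
  cq_eq : cq ∘ f = cq ∘ g;
  cq_desc : forall (Z : C) (h : hom Y Z), h ∘ f = h ∘ g -> hom cq_ob Z;
  cq_descE : forall (Z : C) (h : hom Y Z) (e : h ∘ f = h ∘ g),
    cq_desc e ∘ cq = h;
  cq_epi : forall (Z : C) (u v : hom cq_ob Z), u ∘ cq = v ∘ cq -> u = v
}.

Definition has_coequalizers (C : category) :=
  forall (X Y : C) (f g : hom X Y), coequalizer f g.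

Record comAlgebra (C : braided) := ComAlgebra {
  alg :> C;
  mul : hom (alg ⊗ alg) alg;
  eta : hom one alg;
  mulA : mul ∘ (mul ▷ alg) = mul ∘ (alg ◁ mul) ∘ asc alg alg alg;
  mul1m : mul ∘ (eta ▷ alg) = lu alg;
  mulm1 : mul ∘ (alg ◁ eta) = ru alg;
  mulC : mul ∘ br alg alg = mul
}.

Arguments mul {C} c.
Arguments eta {C} c.

Record rmodule (C : braided) (A : comAlgebra C) := RModule {
  car :> C;
  act : hom (car ⊗ A) car;
  actA : act ∘ (act ▷ A) = act ∘ (car ◁ mul A) ∘ asc car A A;
  act1 : act ∘ (car ◁ eta A) = ru car
}.

Arguments act {C A} r.

Record modhom (C : braided) (A : comAlgebra C) (M N : rmodule A) := ModHom {
  mh :> hom M N;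
  mhP : mh ∘ act M = act N ∘ (mh ▷ A)
}.

Definition is_local (C : braided) (A : comAlgebra C) (M : rmodule A) :=
  act M ∘ br A M ∘ br M A = act M.

Definition lact (C : braided) (A : comAlgebra C) (M : rmodule A) :
  hom (A ⊗ M) M := act M ∘ br A M.

Section CatFacts.
Variable C : category.
Implicit Types X Y Z W : C.


Lemma k20 X Y (f : hom Y X) (g : hom X Y) :
  f ∘ g = idm X -> forall V (k : hom V X), f ∘ g ∘ k = k.
Proof. by move=> H V k; rewrite -compA H comp1m. Qed.
Lemma k21 X Y Z (f : hom Y Z) (g : hom X Y) r :
  f ∘ g = r -> forall V (k : hom V X), f ∘ g ∘ k = r ∘ k.
Proof. by move=> <- V k; rewrite -compA. Qed.
Lemma k22 X Y Y' Z (f : hom Y Z) (g : hom X Y) (r : hom Y' Z) (s : hom X Y') :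
  f ∘ g = r ∘ s -> forall V (k : hom V X), f ∘ g ∘ k = r ∘ s ∘ k.
Proof. by move=> H V k; rewrite -!compA H. Qed.
Lemma k23 X Y Y' Y'' Z (f : hom Y Z) (g : hom X Y)
    (r : hom Y' Z) (s : hom Y'' Y') (t : hom X Y'') :
  f ∘ g = r ∘ s ∘ t -> forall V (k : hom V X), f ∘ g ∘ k = r ∘ s ∘ t ∘ k.
Proof. by move=> H V k; rewrite -[f ∘ _ ∘ _]compA H !compA. Qed.
Lemma k31 X Y Z T (f : hom Z T) (g : hom Y Z) (h : hom X Y) r :
  f ∘ g ∘ h = r -> forall V (k : hom V X), f ∘ g ∘ h ∘ k = r ∘ k.
Proof. by move=> <- V k; rewrite !compA. Qed.

Definition epi X Y (f : hom X Y) :=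
  forall Z (u v : hom Y Z), u ∘ f = v ∘ f -> u = v.

Lemma epi_comp X Y Z (f : hom Y Z) (g : hom X Y) :
  epi f -> epi g -> epi (f ∘ g).
Proof. by move=> ef eg T u v; rewrite -!compA => /eg /ef. Qed.

Lemma epi_iso X Y (f : hom X Y) (g : hom Y X) : f ∘ g = idm Y -> epi f.
Proof.
by move=> H T u v e; rewrite -[u]compm1 -[v]compm1 -H -!compA e.
Qed.

End CatFacts.

(* Proofs are carried out on right-nested tensor products
   X1 ⊗ (X2 ⊗ (... ⊗ W)) with an arbitrary last factor W, where associators do
   not show up: a morphism f : X ⊗ Y -> Z, say, is replaced by
   h21 f W : X ⊗ (Y ⊗ W) -> Z ⊗ W. *)
Section MonFacts.
Variable C : monoidal.
Implicit Types X Y Z W V : C.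

Lemma wr_comp X Y Z (f : hom Y Z) (g : hom X Y) W :
  (f ∘ g) ▷ W = (f ▷ W) ∘ (g ▷ W).
Proof. by rewrite -tenm_comp comp1m. Qed.
Lemma wl_comp X Y Z (f : hom Y Z) (g : hom X Y) W :
  W ◁ (f ∘ g) = (W ◁ f) ∘ (W ◁ g).
Proof. by rewrite -tenm_comp comp1m. Qed.
Lemma xchg X X' Y Y' (f : hom X X') (g : hom Y Y') :
  (f ▷ Y') ∘ (X ◁ g) = (X' ◁ g) ∘ (f ▷ Y).
Proof. by rewrite -!tenm_comp !comp1m !compm1. Qed.
Lemma tenmE X X' Y Y' (f : hom X X') (g : hom Y Y') :
  f ⊠ g = (f ▷ Y') ∘ (X ◁ g).
Proof. by rewrite -!tenm_comp !comp1m !compm1. Qed.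

Lemma w20 X Y (f : hom Y X) (g : hom X Y) W :
  f ∘ g = idm X -> (W ◁ f) ∘ (W ◁ g) = idm _.
Proof. by move=> H; rewrite -wl_comp H tenm_id. Qed.
Lemma w21 X Y Z (f : hom Y Z) (g : hom X Y) r W :
  f ∘ g = r -> (W ◁ f) ∘ (W ◁ g) = W ◁ r.
Proof. by move=> <-; rewrite -wl_comp. Qed.
Lemma w22 X Y Y' Z (f : hom Y Z) (g : hom X Y) (r : hom Y' Z) (s : hom X Y') W :
  f ∘ g = r ∘ s -> (W ◁ f) ∘ (W ◁ g) = (W ◁ r) ∘ (W ◁ s).
Proof. by move=> H; rewrite -!wl_comp H. Qed.
Lemma w23 X Y Y' Y'' Z (f : hom Y Z) (g : hom X Y)
    (r : hom Y' Z) (s : hom Y'' Y') (t : hom X Y'') W :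
  f ∘ g = r ∘ s ∘ t -> (W ◁ f) ∘ (W ◁ g) = (W ◁ r) ∘ (W ◁ s) ∘ (W ◁ t).
Proof. by move=> H; rewrite -!wl_comp H. Qed.
Lemma r20 X Y (f : hom Y X) (g : hom X Y) W :
  f ∘ g = idm X -> (f ▷ W) ∘ (g ▷ W) = idm _.
Proof. by move=> H; rewrite -wr_comp H tenm_id. Qed.

Lemma wfaith X Y (f g : hom X Y) : (forall W, f ▷ W = g ▷ W) -> f = g.
Proof.
move=> /(_ one) H.
by rewrite -[f]compm1 -[g]compm1 -ruiK -!compA -!ru_nat H.
Qed.

Lemma one_wl X Y (f : hom X Y) : one ◁ f = lui Y ∘ f ∘ lu X.
Proof. by rewrite -lu_nat -compA luK comp1m. Qed.
Lemma lui_nat X Y (f : hom X Y) : lui Y ∘ f = (one ◁ f) ∘ lui X.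
Proof. by rewrite one_wl !compA luiK compm1. Qed.
Lemma rui_nat X Y (f : hom X Y) : rui Y ∘ f = (f ▷ one) ∘ rui X.
Proof.
by rewrite -[f ▷ one]comp1m -ruK !compA -(compA (ru Y)) ru_nat !compA ruiK compm1.
Qed.

Lemma one_wl_inj X Y (f g : hom X Y) : one ◁ f = one ◁ g -> f = g.
Proof.
by move=> H; rewrite -[f]compm1 -[g]compm1 -luiK -!compA -!lu_nat H.
Qed.

Lemma asci_nat X X' Y Y' Z Z' (f : hom X X') (g : hom Y Y') (h : hom Z Z') :
  asci X' Y' Z' ∘ (f ⊠ (g ⊠ h)) = ((f ⊠ g) ⊠ h) ∘ asci X Y Z.
Proof.
rewrite -[RHS]comp1m -ascK compA -(compA _ _ (asci X Y Z)) asc_nat.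
by rewrite !compA asciK compm1.
Qed.

Lemma wr_wr X X' (f : hom X X') Y W :
  (f ▷ Y) ▷ W = asci X' Y W ∘ (f ▷ (Y ⊗ W)) ∘ asc X Y W.
Proof. by rewrite -(tenm_id Y W) -asc_nat -compA ascK comp1m. Qed.
Lemma wl_wr X Y Y' (f : hom Y Y') W :
  (X ◁ f) ▷ W = asci X Y' W ∘ (X ◁ (f ▷ W)) ∘ asc X Y W.
Proof. by rewrite -asc_nat -compA ascK comp1m. Qed.
Lemma wl_ten X Y Z Z' (f : hom Z Z') :
  (X ⊗ Y) ◁ f = asci X Y Z' ∘ (X ◁ (Y ◁ f)) ∘ asc X Y Z.
Proof. by rewrite -asc_nat tenm_id -compA ascK comp1m. Qed.
Lemma wr_ten X X' (f : hom X X') Y W :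
  f ▷ (Y ⊗ W) = asc X' Y W ∘ ((f ▷ Y) ▷ W) ∘ asci X Y W.
Proof. by rewrite -(tenm_id Y W) -compA asc_nat compA asciK compm1. Qed.

Lemma asc_wr X Y Z W :
  asc X Y Z ▷ W = asci X (Y ⊗ Z) W ∘ (X ◁ asci Y Z W) ∘
                  asc X Y (Z ⊗ W) ∘ asc (X ⊗ Y) Z W.
Proof.
by rewrite pentagon (k20 (w20 X (ascK Y Z W))) (k20 (ascK _ _ _)).
Qed.
Lemma asci_wr X Y Z W :
  asci X Y Z ▷ W = asci (X ⊗ Y) Z W ∘ asci X Y (Z ⊗ W) ∘
                   (X ◁ asc Y Z W) ∘ asc X (Y ⊗ Z) W.
Proof.
rewrite -[LHS]comp1m -(ascK (X ⊗ Y)) -[asc (X ⊗ Y) Z W]comp1m -ascK.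
rewrite !compA -(compA (asc X Y _) (asc _ _ _)) pentagon !compA.
by rewrite -wr_comp asciK tenm_id compm1.
Qed.

Lemma lu_wr X W : lu X ▷ W = lu (X ⊗ W) ∘ asc one X W.
Proof.
apply: one_wl_inj.
have e : epi (asc one (one ⊗ X) W ∘ (asc one one X ▷ W)).
  apply: epi_comp; first exact: epi_iso (asciK _ _ _).
  by apply: (epi_iso (g := asci _ _ _ ▷ W)); rewrite -wr_comp asciK tenm_id.
apply: e; rewrite wl_comp !compA.
rewrite -pentagon.
rewrite -(compA _ (asc one one _)) triangle.
rewrite -(compA _ (asc one _ W)) -[in LHS]asc_nat compA -wr_comp triangle.
by rewrite -[in RHS](tenm_id X W) -asc_nat.
Qed.
Lemma ru_wr X W : ru X ▷ W = (X ◁ lu W) ∘ asc X one W.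
Proof. by rewrite triangle. Qed.
Lemma lui_wr X W : lui X ▷ W = asci one X W ∘ lui (X ⊗ W).
Proof.
rewrite -[RHS]compm1 -(r20 W (luiK X)) lu_wr !compA.
by rewrite (k20 (luK _)) (k20 (ascK _ _ _)).
Qed.
Lemma rui_wr X W : rui X ▷ W = asci X one W ∘ (X ◁ lui W).
Proof.
rewrite -[RHS]compm1 -(r20 W (ruiK X)) ru_wr !compA.
by rewrite (k20 (w20 X (luK _))) (k20 (ascK _ _ _)).
Qed.
Lemma ru_ten X Y : ru (X ⊗ Y) = (X ◁ ru Y) ∘ asc X Y one.
Proof.
apply: wfaith => W; rewrite wr_comp -triangle wl_wr -triangle wl_comp !compA.
rewrite asc_wr.
rewrite (k20 (asciK _ _ _)) (k20 (w20 _ (asciK _ _ _))).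
by rewrite wl_ten !compA.
Qed.

(* h21, h20, ...: the two digits are the numbers of tensor factors of source
   and target, besides W. *)
Definition h21 X Y Z (f : hom (X ⊗ Y) Z) W : hom (X ⊗ (Y ⊗ W)) (Z ⊗ W) :=
  locked ((f ▷ W) ∘ asci X Y W).
Definition h01 X (f : hom one X) W : hom W (X ⊗ W) := locked ((f ▷ W) ∘ lui W).
Definition h20 X Y (f : hom (X ⊗ Y) one) W : hom (X ⊗ (Y ⊗ W)) W :=
  locked (lu W ∘ (f ▷ W) ∘ asci X Y W).
Definition h02 X Y (f : hom one (X ⊗ Y)) W : hom W (X ⊗ (Y ⊗ W)) :=
  locked (asc X Y W ∘ (f ▷ W) ∘ lui W).
Definition h22 X Y Z T (f : hom (X ⊗ Y) (Z ⊗ T)) W :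
    hom (X ⊗ (Y ⊗ W)) (Z ⊗ (T ⊗ W)) :=
  locked (asc Z T W ∘ (f ▷ W) ∘ asci X Y W).

Lemma h21_def X Y Z (f : hom (X ⊗ Y) Z) W : h21 f W = (f ▷ W) ∘ asci X Y W.
Proof. exact: esym (lock _). Qed.
Lemma h01_def X (f : hom one X) W : h01 f W = (f ▷ W) ∘ lui W.
Proof. exact: esym (lock _). Qed.
Lemma h20_def X Y (f : hom (X ⊗ Y) one) W :
  h20 f W = lu W ∘ (f ▷ W) ∘ asci X Y W.
Proof. exact: esym (lock _). Qed.
Lemma h02_def X Y (f : hom one (X ⊗ Y)) W :
  h02 f W = asc X Y W ∘ (f ▷ W) ∘ lui W.
Proof. exact: esym (lock _). Qed.
Lemma h22_def X Y Z T (f : hom (X ⊗ Y) (Z ⊗ T)) W :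
  h22 f W = asc Z T W ∘ (f ▷ W) ∘ asci X Y W.
Proof. exact: esym (lock _). Qed.

Lemma h21E X Y Z (f : hom (X ⊗ Y) Z) W : f ▷ W = h21 f W ∘ asc X Y W.
Proof. by rewrite !h21_def compA ascK compm1. Qed.
Lemma h01E X (f : hom one X) W : f ▷ W = h01 f W ∘ lu W.
Proof. by rewrite !h01_def compA luK compm1. Qed.
Lemma h20E X Y (f : hom (X ⊗ Y) one) W :
  f ▷ W = lui W ∘ h20 f W ∘ asc X Y W.
Proof. by rewrite !h20_def !compA ascK compm1 (k20 (luK _)). Qed.
Lemma h02E X Y (f : hom one (X ⊗ Y)) W :
  f ▷ W = asci X Y W ∘ h02 f W ∘ lu W.
Proof. by rewrite !h02_def !compA luK compm1 (k20 (ascK _ _ _)). Qed.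

Lemma h21_nat X Y Z (f : hom (X ⊗ Y) Z) V W (k : hom V W) :
  h21 f W ∘ (X ◁ (Y ◁ k)) = (Z ◁ k) ∘ h21 f V.
Proof.
by rewrite !h21_def !compA asci_nat tenm_id -compA xchg compA.
Qed.
Lemma h01_nat X (f : hom one X) V W (k : hom V W) :
  h01 f W ∘ k = (X ◁ k) ∘ h01 f V.
Proof. by rewrite !h01_def !compA lui_nat -compA xchg compA. Qed.
Lemma h20_nat X Y (f : hom (X ⊗ Y) one) V W (k : hom V W) :
  h20 f W ∘ (X ◁ (Y ◁ k)) = k ∘ h20 f V.
Proof.
rewrite !h20_def !compA asci_nat tenm_id -(compA (f ▷ W)) xchg !compA.
by rewrite (k22 (lu_nat _)).
Qed.
Lemma h02_nat X Y (f : hom one (X ⊗ Y)) V W (k : hom V W) :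
  h02 f W ∘ k = (X ◁ (Y ◁ k)) ∘ h02 f V.
Proof.
rewrite !h02_def !compA lui_nat (k22 (xchg _ _)) -(tenm_id X Y).
by rewrite (k22 (asc_nat _ _ _)).
Qed.
Lemma h22_nat X Y Z T (f : hom (X ⊗ Y) (Z ⊗ T)) V W (k : hom V W) :
  h22 f W ∘ (X ◁ (Y ◁ k)) = (Z ◁ (T ◁ k)) ∘ h22 f V.
Proof.
rewrite !h22_def !compA asci_nat tenm_id -(compA (f ▷ W)) xchg !compA.
by rewrite -(tenm_id Z T) (k22 (asc_nat _ _ _)).
Qed.

Lemma h21_comp X Y Z T (g : hom Z T) (f : hom (X ⊗ Y) Z) W :
  h21 (g ∘ f) W = (g ▷ W) ∘ h21 f W.
Proof. by rewrite !h21_def wr_comp !compA. Qed.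
Lemma h21_comp2 X Y Z T S (g : hom (Z ⊗ T) S) (f : hom (X ⊗ Y) (Z ⊗ T)) W :
  h21 (g ∘ f) W = h21 g W ∘ h22 f W.
Proof. by rewrite !h21_def !h22_def wr_comp !compA (k20 (ascK _ _ _)). Qed.
Lemma h22_comp X Y Z T S U (g : hom (Z ⊗ T) (S ⊗ U))
    (f : hom (X ⊗ Y) (Z ⊗ T)) W :
  h22 (g ∘ f) W = h22 g W ∘ h22 f W.
Proof. by rewrite !h22_def wr_comp !compA (k20 (ascK _ _ _)). Qed.
Lemma h22_id X Y W : h22 (idm (X ⊗ Y)) W = idm _.
Proof. by rewrite !h22_def tenm_id comp1m asciK. Qed.
Lemma h21_wl X Y Y' Z (f : hom (X ⊗ Y') Z) (g : hom Y Y') W :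
  h21 (f ∘ (X ◁ g)) W = h21 f W ∘ (X ◁ (g ▷ W)).
Proof. by rewrite !h21_def wr_comp wl_wr !compA asciK compm1. Qed.
Lemma h21_wr X X' Y Z (f : hom (X' ⊗ Y) Z) (g : hom X X') W :
  h21 (f ∘ (g ▷ Y)) W = h21 f W ∘ (g ▷ (Y ⊗ W)).
Proof. by rewrite !h21_def wr_comp wr_wr !compA asciK compm1. Qed.

Lemma h21_inj X Y Z (f g : hom (X ⊗ Y) Z) :
  (forall W, h21 f W = h21 g W) -> f = g.
Proof. by move=> H; apply: wfaith => W; rewrite !h21E H. Qed.

(* Equality of two maps out of (X ⊗ Y) ⊗ Z, tested on right-nested products. *)
Definition h31 X Y Z T (f : hom ((X ⊗ Y) ⊗ Z) T) W :
  hom (X ⊗ (Y ⊗ (Z ⊗ W))) (T ⊗ W) :=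
  locked ((f ▷ W) ∘ asci (X ⊗ Y) Z W ∘ asci X Y (Z ⊗ W)).
Lemma h31_def X Y Z T (f : hom ((X ⊗ Y) ⊗ Z) T) W :
  h31 f W = (f ▷ W) ∘ asci (X ⊗ Y) Z W ∘ asci X Y (Z ⊗ W).
Proof. exact: esym (lock _). Qed.
Lemma h31_inj X Y Z T (f g : hom ((X ⊗ Y) ⊗ Z) T) :
  (forall W, h31 f W = h31 g W) -> f = g.
Proof.
move=> H; apply: wfaith => W.
have e : epi (asci (X ⊗ Y) Z W ∘ asci X Y (Z ⊗ W)).
  by apply: epi_comp; apply: (epi_iso (ascK _ _ _)).
by move: (H W); rewrite !h31_def; exact: e.
Qed.
Lemma h31_wr X Y Z T P (f : hom (P ⊗ Z) T) (g : hom (X ⊗ Y) P) W :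
  h31 (f ∘ (g ▷ Z)) W = h21 f W ∘ h21 g (Z ⊗ W).
Proof.
by rewrite !h31_def wr_comp wr_wr !compA (k20 (asciK _ _ _)) !h21_def ?compA.
Qed.
Lemma h31_wl X Y Z T P (f : hom (X ⊗ P) T) (g : hom (Y ⊗ Z) P) W :
  h31 (f ∘ (X ◁ g) ∘ asc X Y Z) W = h21 f W ∘ (X ◁ h21 g W).
Proof.
rewrite !h31_def !wr_comp wl_wr asc_wr !compA !(k20 (asciK _ _ _)) asciK compm1.
by rewrite !h21_def ?compA wl_comp ?compA.
Qed.

End MonFacts.

Section DualFacts.
Variable C : monoidal.
Implicit Types X Y Z W V D : C.

Lemma zigzag1_wr D X (ev : hom (D ⊗ X) one) (coev : hom one (X ⊗ D)) W :
  (ru X ∘ (X ◁ ev) ∘ asc X D X ∘ (coev ▷ X) ∘ lui X) ▷ W =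
  (X ◁ h20 ev W) ∘ h02 coev (X ⊗ W).
Proof.
rewrite !wr_comp ru_wr wl_wr asc_wr wr_wr lui_wr ?compA.
by rewrite ?(k20 (asciK _ _ _)) ?h20_def ?h02_def !wl_comp ?compA.
Qed.
Lemma zigzag2_wr D X (ev : hom (D ⊗ X) one) (coev : hom one (X ⊗ D)) W :
  (lu D ∘ (ev ▷ D) ∘ asci D X D ∘ (D ◁ coev) ∘ rui D) ▷ W =
  h20 ev (D ⊗ W) ∘ (D ◁ h02 coev W).
Proof.
rewrite !wr_comp lu_wr wr_wr asci_wr wl_wr rui_wr ?compA.
by rewrite ?(k20 (asciK _ _ _)) ?h20_def ?h02_def !wl_comp ?compA.
Qed.

Lemma zz1h X (D : leftDual X) W :
  (X ◁ h20 (ev D) W) ∘ h02 (coev D) (X ⊗ W) = idm _.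
Proof. by rewrite -zigzag1_wr (ldual_zz1 D) tenm_id. Qed.
Lemma zz2h X (D : leftDual X) W :
  h20 (ev D) (D ⊗ W) ∘ (D ◁ h02 (coev D) W) = idm _.
Proof. by rewrite -zigzag2_wr (ldual_zz2 D) tenm_id. Qed.

Lemma h20_wr X Y (f : hom (X ⊗ Y) one) W V :
  h20 f W ▷ V = h20 f (W ⊗ V) ∘ (X ◁ asc Y W V) ∘ asc X (Y ⊗ W) V.
Proof.
rewrite !h20_def !wr_comp lu_wr wr_wr asci_wr ?compA.
by rewrite !(k20 (asciK _ _ _)).
Qed.
Lemma h02_wr X Y (f : hom one (X ⊗ Y)) W V :
  h02 f W ▷ V = asci X (Y ⊗ W) V ∘ (X ◁ asci Y W V) ∘ h02 f (W ⊗ V).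
Proof.
rewrite !h02_def !wr_comp lui_wr wr_wr asc_wr ?compA.
by rewrite !(k20 (asciK _ _ _)).
Qed.
Lemma rui_ten X Y : rui (X ⊗ Y) = asci X Y one ∘ (X ◁ rui Y).
Proof.
rewrite -[RHS]comp1m -ruK ru_ten ?compA (k20 (asciK _ _ _)).
by rewrite (w20 _ (ruiK _)) compm1.
Qed.

Section TensorDual.
Variables (X Y : C) (DX : leftDual X) (DY : leftDual Y).

(* The left dual of X ⊗ Y on the object Y^* ⊗ X^*. *)
Definition ten_ev : hom ((DY ⊗ DX) ⊗ (X ⊗ Y)) one :=
  ev DY ∘ (DY ◁ (lu Y ∘ (ev DX ▷ Y) ∘ asci DX X Y)) ∘ asc DY DX (X ⊗ Y).
Definition ten_coev : hom one ((X ⊗ Y) ⊗ (DY ⊗ DX)) :=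
  asci X Y (DY ⊗ DX) ∘ (X ◁ (asc Y DY DX ∘ (coev DY ▷ DX) ∘ lui DX)) ∘ coev DX.

Lemma ten_evE : ten_ev = ev DY ∘ (DY ◁ h20 (ev DX) Y) ∘ asc DY DX (X ⊗ Y).
Proof. by rewrite h20_def. Qed.
Lemma ten_coevE :
  ten_coev = asci X Y (DY ⊗ DX) ∘ (X ◁ h02 (coev DY) DX) ∘ coev DX.
Proof. by rewrite h02_def. Qed.

Lemma ten_zz1 : zigzag1 ten_ev ten_coev.
Proof.
rewrite /zigzag1 ten_evE ten_coevE ru_ten wl_ten !wr_comp asci_wr wl_wr h02_wr.
rewrite !wl_comp ?compA (h02E (coev DX)) ?compA luiK compm1.
rewrite !(k20 (asciK _ _ _)) (k20 (w20 _ (asciK _ _ _))).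
rewrite (k20 (w20 _ (w20 _ (asciK _ _ _)))).
rewrite (k22 (w22 X (esym (h02_nat (coev DY) (h20 (ev DX) Y))))).
rewrite zz1h compm1 -!wl_comp h02_def.
by have -> := ldual_zz1 DY; rewrite tenm_id.
Qed.

Lemma ten_zz2 : zigzag2 ten_ev ten_coev.
Proof.
rewrite /zigzag2 ten_evE ten_coevE rui_ten wl_ten !wr_comp wl_wr asc_wr h20_wr.
rewrite !wl_comp ?compA (h20E (ev DY)) ?compA.
rewrite !(k20 (asciK _ _ _)) (k20 (luiK _)) (k20 (w20 _ (asciK _ _ _))).
rewrite (k20 (w20 _ (w20 _ (asciK _ _ _)))).
rewrite (k22 (w22 DY (h20_nat (ev DX) (h02 (coev DY) DX)))).
rewrite (k20 (zz2h _ _)) -!wl_comp h20_def ?compA.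
by have -> := ldual_zz2 DX; rewrite tenm_id.
Qed.

Definition ten_dual : leftDual (X ⊗ Y) := LeftDual ten_zz1 ten_zz2.

End TensorDual.

Section Transpose.
Variables (W : C) (D : leftDual W).

Definition tr Y Z (h : hom (Y ⊗ W) Z) : hom Y (Z ⊗ D) :=
  (h ▷ D) ∘ asci Y W D ∘ (Y ◁ coev D) ∘ rui Y.
Definition untr Y Z (t : hom Y (Z ⊗ D)) : hom (Y ⊗ W) Z :=
  ru Z ∘ (Z ◁ ev D) ∘ asc Z D W ∘ (t ▷ W).

Lemma trK Y Z (h : hom (Y ⊗ W) Z) : untr (tr h) = h.
Proof.
rewrite /untr /tr !wr_comp wr_wr asci_wr wl_wr rui_wr ?compA.
rewrite !(k20 (asciK _ _ _)) -(k22 (xchg h (ev D))) (k22 (ru_nat _)).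
rewrite ru_ten wl_ten ?compA !(k20 (asciK _ _ _)) -!wl_comp.
by have -> := ldual_zz1 D; rewrite tenm_id compm1.
Qed.
Lemma tr_nat X Y Z (h : hom (Y ⊗ W) Z) (f : hom X Y) :
  tr (h ∘ (f ▷ W)) = tr h ∘ f.
Proof.
rewrite /tr wr_comp ?compA rui_nat -(k22 (xchg f _)) -(tenm_id W D).
by rewrite (k22 (asci_nat _ _ _)).
Qed.
Lemma untr_nat X Y Z (t : hom Y (Z ⊗ D)) (f : hom X Y) :
  untr (t ∘ f) = untr t ∘ (f ▷ W).
Proof. by rewrite /untr wr_comp ?compA. Qed.

Lemma epi_wr X Y (f : hom X Y) : epi f -> epi (f ▷ W).
Proof.
move=> ef Z u v e; rewrite -(trK u) -(trK v); congr untr.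
by apply: ef; rewrite -!tr_nat e.
Qed.

Section Coeq.
Variables (X Y : C) (f g : hom X Y) (Q : coequalizer f g).

Lemma coeqR_aux Z (h : hom (Y ⊗ W) Z) :
  h ∘ (f ▷ W) = h ∘ (g ▷ W) -> tr h ∘ f = tr h ∘ g.
Proof. by move=> e; rewrite -!tr_nat e. Qed.

(* - ⊗ W preserves coequalizers when W has a dual. *)
Definition coeqR : coequalizer (f ▷ W) (g ▷ W).
Proof.
refine (@Coequalizer C _ _ (f ▷ W) (g ▷ W) (cq_ob Q ⊗ W) (cq Q ▷ W) _
          (fun Z h e => untr (cq_desc Q (coeqR_aux e))) _ _).
- by rewrite -!wr_comp cq_eq.
- by move=> Z h e; rewrite -untr_nat cq_descE trK.
- by apply: epi_wr => Z u v; apply: cq_epi.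
Defined.
End Coeq.
End Transpose.

End DualFacts.

Section BraidFacts.
Variable C : braided.
Implicit Types X Y Z W V T : C.

Definition hb X Y W : hom (X ⊗ (Y ⊗ W)) (Y ⊗ (X ⊗ W)) := h22 (br X Y) W.
Definition hbi X Y W : hom (Y ⊗ (X ⊗ W)) (X ⊗ (Y ⊗ W)) := h22 (bri X Y) W.

Lemma hbK X Y W : hbi X Y W ∘ hb X Y W = idm _.
Proof. by rewrite /hb /hbi -h22_comp brK h22_id. Qed.
Lemma hbiK X Y W : hb X Y W ∘ hbi X Y W = idm _.
Proof. by rewrite /hb /hbi -h22_comp briK h22_id. Qed.
Lemma hb_nat X Y V W (k : hom V W) :
  hb X Y W ∘ (X ◁ (Y ◁ k)) = (Y ◁ (X ◁ k)) ∘ hb X Y V.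
Proof. exact: h22_nat. Qed.

Lemma hb_r X Y Z T (f : hom (Y ⊗ Z) T) W :
  hb X T W ∘ (X ◁ h21 f W) =
  h21 f (X ⊗ W) ∘ (Y ◁ hb X Z W) ∘ hb X Y (Z ⊗ W).
Proof.
have E : br X (Y ⊗ Z) = asci Y Z X ∘ (Y ◁ br X Z) ∘ asc Y X Z ∘
           (br X Y ▷ Z) ∘ asci X Y Z.
  by rewrite (k31 (esym (hexagon1 X Y Z))) ?compA asciK compm1 (k20 (ascK _ _ _)).
rewrite {1}/hb !h22_def {1}h21_def ?compA wl_comp.
have -> : asci X T W ∘ (X ◁ (f ▷ W)) ∘ (X ◁ asci Y Z W) =
    ((X ◁ f) ▷ W) ∘ asci X (Y ⊗ Z) W ∘ (X ◁ asci Y Z W).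
  by rewrite wl_wr ?compA (k20 (asciK _ _ _)).
rewrite -(compA (br X T ▷ W)) -wr_comp br_nat wr_comp wr_wr E !wr_comp ?compA.
rewrite !(k20 (asciK _ _ _)) asci_wr !wl_wr !asc_wr !wr_wr asci_wr ?compA.
rewrite !(k20 (asciK _ _ _)) (w20 _ (asciK _ _ _)) compm1.
by rewrite !h21_def /hb !h22_def !wl_comp ?compA.
Qed.

Lemma hb_l X Y Z T (f : hom (X ⊗ Y) T) W :
  hb T Z W ∘ h21 f (Z ⊗ W) =
  (Z ◁ h21 f W) ∘ hb X Z (Y ⊗ W) ∘ (X ◁ hb Y Z W).
Proof.
have E : br (X ⊗ Y) Z = asc Z X Y ∘ (br X Z ▷ Y) ∘ asci X Z Y ∘
           (X ◁ br Y Z) ∘ asc X Y Z.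
  by rewrite (k31 (esym (hexagon2 X Y Z))) ?compA ascK compm1 (k20 (asciK _ _ _)).
rewrite {1}/hb !h22_def {1}h21_def ?compA.
rewrite wr_ten ?compA (k20 (ascK _ _ _)).
rewrite -(compA (br T Z ▷ W)) -wr_comp br_nat wr_comp wl_wr E !wr_comp ?compA.
rewrite !(k20 (asciK _ _ _)) asci_wr !wl_wr !asc_wr !wr_wr ?compA.
rewrite !(k20 (asciK _ _ _)) asciK compm1.
by rewrite !h21_def /hb !h22_def !wl_comp ?compA.
Qed.

Lemma hb_r1 X Y T (f : hom Y T) W :
  hb X T W ∘ (X ◁ (f ▷ W)) = (f ▷ (X ⊗ W)) ∘ hb X Y W.
Proof.
rewrite /hb !h22_def ?compA (asci_nat (idm X) f (idm W)).
rewrite -(compA (br X T ▷ W)) -wr_comp br_nat wr_comp.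
by rewrite ?compA -(compA (asc T X W)) asc_nat tenm_id ?compA.
Qed.
Lemma hb_l1 X T Z (f : hom X T) W :
  hb T Z W ∘ (f ▷ (Z ⊗ W)) = (Z ◁ (f ▷ W)) ∘ hb X Z W.
Proof.
rewrite /hb !h22_def ?compA -(tenm_id Z W) (asci_nat f (idm Z) (idm W)).
rewrite -(compA (br T Z ▷ W)) -wr_comp br_nat wr_comp.
by rewrite ?compA -(compA (asc Z T W)) asc_nat ?compA.
Qed.

Lemma hbi_r X Y Z T (f : hom (Y ⊗ Z) T) W :
  hbi X T W ∘ h21 f (X ⊗ W) =
  (X ◁ h21 f W) ∘ hbi X Y (Z ⊗ W) ∘ (Y ◁ hbi X Z W).
Proof.
rewrite -[RHS]comp1m -(hbK X T) ?compA.
by rewrite (k23 (hb_r X f _)) (k20 (hbiK _ _ _)) (w20 _ (hbiK _ _ _)) compm1.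
Qed.
Lemma hbi_l X Y Z T (f : hom (X ⊗ Y) T) W :
  hbi T Z W ∘ (Z ◁ h21 f W) =
  h21 f (Z ⊗ W) ∘ (X ◁ hbi Y Z W) ∘ hbi X Z (Y ⊗ W).
Proof.
rewrite -[RHS]comp1m -(hbK T Z) ?compA.
by rewrite (k23 (hb_l Z f _)) (k20 (w20 _ (hbiK _ _ _))) hbiK compm1.
Qed.

Lemma bri_nat X X' Y Y' (f : hom X X') (g : hom Y Y') :
  bri X' Y' ∘ (g ⊠ f) = (f ⊠ g) ∘ bri X Y.
Proof.
by rewrite -[RHS]comp1m -(brK X') ?compA (k22 (br_nat _ _)) briK compm1.
Qed.

End BraidFacts.

Section CoeqL.
Variables (C : braided) (W : C) (D : leftDual W).

Lemma epi_wl (X Y : C) (f : hom X Y) : epi f -> epi (W ◁ f).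
Proof.
move=> /(epi_wr D) ef Z u v e.
have eb : epi (br Y W) by apply: (epi_iso (briK _ _)).
by apply: eb; apply: ef; rewrite ?compA br_nat -?compA e.
Qed.

Variables (X Y : C) (f g : hom X Y) (Q : coequalizer f g).

Lemma coeqL_aux Z (h : hom (W ⊗ Y) Z) :
  h ∘ (W ◁ f) = h ∘ (W ◁ g) ->
  (h ∘ br Y W) ∘ (f ▷ W) = (h ∘ br Y W) ∘ (g ▷ W).
Proof. by move=> e; rewrite ?compA !br_nat -?compA e. Qed.

Definition coeqL : coequalizer (W ◁ f) (W ◁ g).
Proof.
refine (@Coequalizer C _ _ (W ◁ f) (W ◁ g) (W ⊗ cq_ob Q) (W ◁ cq Q) _
  (fun Z h e => cq_desc (coeqR D Q) (coeqL_aux e) ∘ bri (cq_ob Q) W) _ _).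
- by rewrite -!wl_comp cq_eq.
- move=> Z h e; rewrite compA bri_nat -compA.
  by have /= -> := cq_descE (coeqR D Q) (coeqL_aux e); rewrite compA briK compm1.
- by apply: epi_wl => Z u v; apply: cq_epi.
Defined.

End CoeqL.

Section MoreHats.
Variable C : monoidal.
Implicit Types X Y Z U W V P T : C.

Lemma h21_unitr X Y (f : hom (X ⊗ Y) X) (g : hom one Y) W :
  f ∘ (X ◁ g) = ru X -> h21 f W ∘ (X ◁ h01 g W) = idm _.
Proof.
move=> /(congr1 (fun u => u ▷ W)).
rewrite wr_comp wl_wr ru_wr -!compA -h21_def => H.
have e : epi (asc X one W) by apply: (epi_iso (asciK _ _ _)).
by rewrite h01_def wl_comp -compA (e _ _ _ H) (w20 _ (luiK _)).
Qed.
Lemma h21_unitl X Y (f : hom (Y ⊗ X) X) (g : hom one Y) W :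
  f ∘ (g ▷ X) = lu X -> h21 f W ∘ h01 g (X ⊗ W) = idm _.
Proof.
move=> /(congr1 (fun u => u ▷ W)).
rewrite wr_comp wr_wr lu_wr -!compA -h21_def => H.
have e : epi (asc one X W) by apply: (epi_iso (asciK _ _ _)).
by rewrite h01_def -compA (e _ _ _ H) luiK.
Qed.

Definition h41 X Y Z U T (f : hom (((X ⊗ Y) ⊗ Z) ⊗ U) T) W :
  hom (X ⊗ (Y ⊗ (Z ⊗ (U ⊗ W)))) (T ⊗ W) :=
  locked ((f ▷ W) ∘ asci ((X ⊗ Y) ⊗ Z) U W ∘ asci (X ⊗ Y) Z (U ⊗ W) ∘
    asci X Y (Z ⊗ (U ⊗ W))).
Lemma h41_def X Y Z U T (f : hom (((X ⊗ Y) ⊗ Z) ⊗ U) T) W :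
  h41 f W = (f ▷ W) ∘ asci ((X ⊗ Y) ⊗ Z) U W ∘ asci (X ⊗ Y) Z (U ⊗ W) ∘
    asci X Y (Z ⊗ (U ⊗ W)).
Proof. exact: esym (lock _). Qed.
Lemma h41_inj X Y Z U T (f g : hom (((X ⊗ Y) ⊗ Z) ⊗ U) T) :
  (forall W, h41 f W = h41 g W) -> f = g.
Proof.
move=> H; apply: wfaith => W; move: (H W); rewrite !h41_def.
have e : epi (asci ((X ⊗ Y) ⊗ Z) U W ∘ asci (X ⊗ Y) Z (U ⊗ W) ∘
    asci X Y (Z ⊗ (U ⊗ W))).
  apply: epi_comp; first exact: (epi_iso (ascK _ _ _)).
  by apply: epi_comp; apply: (epi_iso (ascK _ _ _)).
exact: e.
Qed.
Lemma h41_wr X Y Z U T P (f : hom ((P ⊗ Z) ⊗ U) T) (g : hom (X ⊗ Y) P) W :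
  h41 (f ∘ ((g ▷ Z) ▷ U)) W = h31 f W ∘ h21 g (Z ⊗ (U ⊗ W)).
Proof.
by rewrite h41_def h31_def h21_def wr_comp !wr_wr ?compA !(k20 (asciK _ _ _)).
Qed.
Lemma h41_mid X Y Z U T P (f : hom ((X ⊗ P) ⊗ U) T) (g : hom (Y ⊗ Z) P) W :
  h41 (f ∘ (((X ◁ g) ∘ asc X Y Z) ▷ U)) W = h31 f W ∘ (X ◁ h21 g (U ⊗ W)).
Proof.
rewrite h41_def h31_def h21_def wr_comp [(_ ▷ U) ▷ W]wr_wr ?compA.
rewrite (k20 (asciK _ _ _)) wr_comp ?compA wl_wr asc_wr ?compA.
by rewrite !(k20 (asciK _ _ _)) asciK compm1 wl_comp.
Qed.

Definition h31r X Y Z T (f : hom (X ⊗ (Y ⊗ Z)) T) W :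
  hom (X ⊗ (Y ⊗ (Z ⊗ W))) (T ⊗ W) :=
  locked ((f ▷ W) ∘ asci X (Y ⊗ Z) W ∘ (X ◁ asci Y Z W)).
Lemma h31r_def X Y Z T (f : hom (X ⊗ (Y ⊗ Z)) T) W :
  h31r f W = (f ▷ W) ∘ asci X (Y ⊗ Z) W ∘ (X ◁ asci Y Z W).
Proof. exact: esym (lock _). Qed.
Lemma h31r_wl X Y Z T P (f : hom (X ⊗ P) T) (g : hom (Y ⊗ Z) P) W :
  h31r (f ∘ (X ◁ g)) W = h21 f W ∘ (X ◁ h21 g W).
Proof.
by rewrite h31r_def !h21_def wr_comp wl_wr ?compA (k20 (asciK _ _ _)) wl_comp.
Qed.
Lemma h31r_wr X Y Z T P (f : hom (P ⊗ Z) T) (g : hom (X ⊗ Y) P) W :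
  h31r (f ∘ (g ▷ Z) ∘ asci X Y Z) W = h21 f W ∘ h21 g (Z ⊗ W).
Proof.
rewrite h31r_def !h21_def !wr_comp wr_wr asci_wr ?compA !(k20 (asciK _ _ _)).
by rewrite (w20 _ (asciK _ _ _)) compm1.
Qed.

Definition h41r X Y Z U T (f : hom (X ⊗ ((Y ⊗ Z) ⊗ U)) T) W :
  hom (X ⊗ (Y ⊗ (Z ⊗ (U ⊗ W)))) (T ⊗ W) :=
  locked ((f ▷ W) ∘ asci X ((Y ⊗ Z) ⊗ U) W ∘ (X ◁ asci (Y ⊗ Z) U W) ∘
    (X ◁ asci Y Z (U ⊗ W))).
Lemma h41r_def X Y Z U T (f : hom (X ⊗ ((Y ⊗ Z) ⊗ U)) T) W :
  h41r f W = (f ▷ W) ∘ asci X ((Y ⊗ Z) ⊗ U) W ∘ (X ◁ asci (Y ⊗ Z) U W) ∘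
    (X ◁ asci Y Z (U ⊗ W)).
Proof. exact: esym (lock _). Qed.
Lemma h41r_inj X Y Z U T (f g : hom (X ⊗ ((Y ⊗ Z) ⊗ U)) T) :
  (forall W, h41r f W = h41r g W) -> f = g.
Proof.
move=> H; apply: wfaith => W; move: (H W); rewrite !h41r_def.
have e : epi (asci X ((Y ⊗ Z) ⊗ U) W ∘ (X ◁ asci (Y ⊗ Z) U W) ∘
    (X ◁ asci Y Z (U ⊗ W))).
  apply: epi_comp; first exact: (epi_iso (ascK _ _ _)).
  by apply: epi_comp; apply: (epi_iso (w20 _ (ascK _ _ _))).
exact: e.
Qed.
Lemma h41r_wr X Y Z U T P (f : hom (X ⊗ (P ⊗ U)) T) (g : hom (Y ⊗ Z) P) W :
  h41r (f ∘ (X ◁ (g ▷ U))) W = h31r f W ∘ (X ◁ h21 g (U ⊗ W)).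
Proof.
rewrite h41r_def h31r_def h21_def wr_comp wl_wr wr_wr !wl_comp ?compA.
by rewrite (k20 (asciK _ _ _)) (k20 (w20 _ (asciK _ _ _))).
Qed.
Lemma h41r_mid X Y Z U T P (f : hom (X ⊗ (Y ⊗ P)) T) (g : hom (Z ⊗ U) P) W :
  h41r (f ∘ (X ◁ ((Y ◁ g) ∘ asc Y Z U))) W = h31r f W ∘ (X ◁ (Y ◁ h21 g W)).
Proof.
rewrite h41r_def h31r_def h21_def !wl_comp !wr_comp !wl_wr asc_wr !wl_comp ?compA.
rewrite !(k20 (asciK _ _ _)) !(k20 (w20 _ (asciK _ _ _))).
by rewrite (w20 _ (asciK _ _ _)) compm1.
Qed.

End MoreHats.

Section BraidUnit.
Variable C : braided.
Implicit Types X Y Z W : C.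

Lemma wl_lu W : one ◁ lu W = lu (one ⊗ W :> C).
Proof. by rewrite -[LHS]comp1m -luK ?compA lu_nat -compA luK comp1m. Qed.

Lemma hb_one Z W : (Z ◁ lu W) ∘ hb one Z W = lu (Z ⊗ W).
Proof.
set p := (Z ◁ lu W) ∘ hb one Z W.
have E : p ∘ lu (one ⊗ (Z ⊗ W)) = p ∘ (one ◁ p).
  have := hb_l Z (lu one) W.
  have L V : h21 (lu (one : C)) V = lu (one ⊗ V).
    by rewrite h21_def lu_wr compA asciK compm1.
  rewrite !L => /(congr1 (fun u => (Z ◁ lu W) ∘ u)).
  rewrite -!compA -/p => ->; rewrite -wl_lu !compA.
  by rewrite -(k22 (hb_nat _ _ _)) -wl_comp.
apply: one_wl_inj; rewrite wl_lu.
have K : (hbi one Z W ∘ (Z ◁ lui W)) ∘ p = idm _.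
  by rewrite /p !compA (k20 (w20 _ (luK _))) hbK.
clearbody p.
by rewrite -[LHS]comp1m -[RHS]comp1m -!K !compA -E.
Qed.

Lemma hb_l0 X Z (f : hom one X) W : hb X Z W ∘ h01 f (Z ⊗ W) = Z ◁ h01 f W.
Proof.
rewrite !h01_def -compA hb_l1 wl_comp !compA; congr (_ ∘ _).
by rewrite -[LHS]comp1m -(w20 _ (luK W)) compA (k21 (hb_one _ _)) luiK compm1.
Qed.

End BraidUnit.

Section Modules.
Variables (C : braided) (R : rigid C) (Q : has_coequalizers C).
Variable A : comAlgebra C.
Implicit Types (M N P : rmodule A) (W X Y Z : C).

Lemma modhom_eq M N (f g : modhom M N) : mh f = mh g -> f = g.
Proof.
by case: f g => [f pf] [g pg] /= e; subst g; rewrite (proof_irrelevance _ pf pg).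
Qed.

Lemma hm_assoc W :
  h21 (mul A) W ∘ h21 (mul A) (A ⊗ W) = h21 (mul A) W ∘ (A ◁ h21 (mul A) W).
Proof. by rewrite -h31_wr -h31_wl mulA. Qed.
Lemma hm_C W : h21 (mul A) W ∘ hb A A W = h21 (mul A) W.
Proof. by rewrite -h21_comp2 mulC. Qed.
Lemma hm_1l W : h21 (mul A) W ∘ h01 (eta A) (A ⊗ W) = idm _.
Proof. exact: h21_unitl (mul1m A). Qed.
Lemma hm_1r W : h21 (mul A) W ∘ (A ◁ h01 (eta A) W) = idm _.
Proof. exact: h21_unitr (mulm1 A). Qed.

Lemma ha_assoc M W :
  h21 (act M) W ∘ h21 (act M) (A ⊗ W) = h21 (act M) W ∘ (M ◁ h21 (mul A) W).
Proof. by rewrite -h31_wr -h31_wl actA. Qed.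
Lemma ha_1 M W : h21 (act M) W ∘ (M ◁ h01 (eta A) W) = idm _.
Proof. exact: h21_unitr (act1 M). Qed.
Lemma hlE M W : h21 (lact M) W = h21 (act M) W ∘ hb A M W.
Proof. exact: h21_comp2. Qed.
Lemma hl_assoc M W :
  h21 (lact M) W ∘ h21 (mul A) (M ⊗ W) = h21 (lact M) W ∘ (A ◁ h21 (lact M) W).
Proof.
rewrite !hlE !compA hb_l wl_comp (k23 (hb_r A (act M) W)).
rewrite (k22 (ha_assoc M W)) (k21 (w21 M (hm_C W))).
by rewrite -(k22 (ha_assoc M W)).
Qed.
Lemma hl_ha M W :
  h21 (act M) W ∘ h21 (lact M) (A ⊗ W) = h21 (lact M) W ∘ (A ◁ h21 (act M) W).
Proof.
rewrite !hlE !compA hb_r !(k22 (ha_assoc M W)).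
by rewrite (k21 (w21 M (hm_C W))).
Qed.
Lemma hl_1 M W : h21 (lact M) W ∘ h01 (eta A) (M ⊗ W) = idm _.
Proof. by rewrite hlE compA hb_l0 ha_1. Qed.

Lemma modhom_h M N (f : modhom M N) W :
  (f ▷ W) ∘ h21 (act M) W = h21 (act N) W ∘ (f ▷ (A ⊗ W)).
Proof. by rewrite -h21_comp mhP h21_wr. Qed.
Lemma modhom_hl M N (f : modhom M N) W :
  (f ▷ W) ∘ h21 (lact M) W = h21 (lact N) W ∘ (A ◁ (f ▷ W)).
Proof. by rewrite !hlE !compA hb_r1 (k22 (modhom_h f W)). Qed.
Lemma modhomP M N (f : hom M N) :
  (forall W, (f ▷ W) ∘ h21 (act M) W = h21 (act N) W ∘ (f ▷ (A ⊗ W))) ->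
  f ∘ act M = act N ∘ (f ▷ A).
Proof. by move=> H; apply: h21_inj => W; rewrite h21_comp h21_wr. Qed.

Definition rmod_id M : modhom M M.
Proof. by exists (idm M); rewrite comp1m tenm_id compm1. Defined.
Definition rmod_comp M N P (g : modhom N P) (f : modhom M N) : modhom M P.
Proof. by exists (g ∘ f); rewrite wr_comp compA mhP -!compA mhP. Defined.

Definition rmod_cat : category.
Proof.
refine (@Category (rmodule A) (@modhom C A) rmod_id rmod_comp _ _ _).
- by move=> M N f; apply: modhom_eq; rewrite /= comp1m.
- by move=> M N f; apply: modhom_eq; rewrite /= compm1.
- by move=> M N P S f g h; apply: modhom_eq; rewrite /= compA.
Defined.

Section Tensor.
Variables M N : rmodule A.

Definition tenA_coeq : coequalizer (act M ▷ N) ((M ◁ lact N) ∘ asc M A N) :=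
  Q (act M ▷ N) ((M ◁ lact N) ∘ asc M A N).
Definition tenA_ob : C := cq_ob tenA_coeq.
Definition qA : hom (M ⊗ N) tenA_ob := cq tenA_coeq.

Lemma hq_bal W :
  h21 qA W ∘ h21 (act M) (N ⊗ W) = h21 qA W ∘ (M ◁ h21 (lact N) W).
Proof. by rewrite -h31_wr -h31_wl (cq_eq tenA_coeq). Qed.

Lemma epi_qA : epi qA.
Proof. by move=> Z u v; apply: cq_epi. Qed.
Lemma epi_hq W : epi (h21 qA W).
Proof.
rewrite h21_def; apply: epi_comp; first exact: (epi_wr (ld R W)) epi_qA.
exact: (epi_iso (ascK _ _ _)).
Qed.

Definition balanced Z (h : hom (M ⊗ N) Z) :=
  h ∘ (act M ▷ N) = h ∘ (M ◁ lact N) ∘ asc M A N.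

Lemma balancedP Z (h : hom (M ⊗ N) Z) :
  (forall W, h21 h W ∘ h21 (act M) (N ⊗ W) = h21 h W ∘ (M ◁ h21 (lact N) W)) ->
  balanced h.
Proof. by move=> H; apply: h31_inj => W; rewrite h31_wr h31_wl. Qed.

Definition bdesc Z (h : hom (M ⊗ N) Z) (e : balanced h) : hom tenA_ob Z :=
  cq_desc tenA_coeq e.
Lemma bdescE Z (h : hom (M ⊗ N) Z) (e : balanced h) : bdesc e ∘ qA = h.
Proof. exact: cq_descE. Qed.
Lemma bdesc_h Z (h : hom (M ⊗ N) Z) (e : balanced h) W :
  (bdesc e ▷ W) ∘ h21 qA W = h21 h W.
Proof. by rewrite -h21_comp bdescE. Qed.

Lemma tenA_act_aux :
  (qA ∘ (M ◁ act N) ∘ asc M N A) ∘ ((act M ▷ N) ▷ A) =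
  (qA ∘ (M ◁ act N) ∘ asc M N A) ∘ (((M ◁ lact N) ∘ asc M A N) ▷ A).
Proof.
apply: h41_inj => W; rewrite h41_wr h41_mid h31_wl !compA.
rewrite -(h21_nat (act M)) (k22 (hq_bal W)).
by rewrite -!wl_comp -hl_ha.
Qed.

Definition tenA_act : hom (tenA_ob ⊗ A) tenA_ob :=
  cq_desc (coeqR (ld R A) tenA_coeq) tenA_act_aux.

Lemma tenA_actE : tenA_act ∘ (qA ▷ A) = qA ∘ (M ◁ act N) ∘ asc M N A.
Proof. exact: (cq_descE (coeqR (ld R A) tenA_coeq) tenA_act_aux). Qed.
Lemma tenA_act_h W :
  h21 tenA_act W ∘ h21 qA (A ⊗ W) = h21 qA W ∘ (M ◁ h21 (act N) W).
Proof. by rewrite -h31_wr -h31_wl tenA_actE. Qed.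

Lemma tenA_actA :
  tenA_act ∘ (tenA_act ▷ A) = tenA_act ∘ (tenA_ob ◁ mul A) ∘ asc tenA_ob A A.
Proof.
apply: h31_inj => W; rewrite h31_wr h31_wl; apply: epi_hq; rewrite !compA.
rewrite -(h21_nat qA) (k22 (tenA_act_h _)) tenA_act_h.
by rewrite (k22 (tenA_act_h _)) (w22 M (ha_assoc N W)).
Qed.
Lemma tenA_act1 : tenA_act ∘ (tenA_ob ◁ eta A) = ru tenA_ob.
Proof.
apply: wfaith => W; rewrite wr_comp wl_wr ru_wr -!compA -h21_def.
congr (_ ∘ _).
rewrite h01E wl_comp -compA.
rewrite -[RHS]comp1m; congr (_ ∘ _); apply: epi_hq.
by rewrite compA -h21_nat (k22 (tenA_act_h _)) (w20 M (ha_1 N W)) compm1 comp1m.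
Qed.

Definition tenA : rmodule A := RModule tenA_actA tenA_act1.

Lemma tenA_lact_h W :
  h21 (lact tenA) W ∘ (A ◁ h21 qA W) = h21 qA W ∘ h21 (lact M) (N ⊗ W).
Proof.
rewrite !hlE !compA (hb_r A qA W) (k22 (tenA_act_h _)).
by rewrite (k21 (w21 M (esym (hlE N W)))) -(k22 (hq_bal W)).
Qed.

End Tensor.

Section TensorMor.
Variables (M M' N N' : rmodule A) (f : modhom M M') (g : modhom N N').

Lemma qA_tenm_h W :
  h21 (qA M' N' ∘ (f ⊠ g)) W =
  h21 (qA M' N') W ∘ (f ▷ (N' ⊗ W)) ∘ (M ◁ (g ▷ W)).
Proof. by rewrite tenmE -compA h21_wl h21_wr compA. Qed.

Lemma tenA_mor_bal : balanced (qA M' N' ∘ (f ⊠ g)).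
Proof.
apply: balancedP => W; rewrite qA_tenm_h !compA -(h21_nat (act M)).
rewrite (k22 (modhom_h f _)) (k22 (hq_bal _ _ _)).
by rewrite -(k22 (xchg f _)) -!wl_comp modhom_hl.
Qed.

Definition tenA_mh : hom (tenA_ob M N) (tenA_ob M' N') := bdesc tenA_mor_bal.
Lemma tenA_mhE : tenA_mh ∘ qA M N = qA M' N' ∘ (f ⊠ g).
Proof. exact: bdescE. Qed.
Lemma tenA_mh_h W :
  (tenA_mh ▷ W) ∘ h21 (qA M N) W =
  h21 (qA M' N') W ∘ (f ▷ (N' ⊗ W)) ∘ (M ◁ (g ▷ W)).
Proof. by rewrite bdesc_h qA_tenm_h. Qed.

Definition tenA_mor : modhom (tenA M N) (tenA M' N').
Proof.
exists tenA_mh; apply: modhomP => W; apply: (epi_hq (M := M)); rewrite !compA.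
rewrite (tenA_act_h M N W) (k23 (tenA_mh_h _)) tenA_mh_h.
rewrite (k22 (tenA_act_h M' N' W)) -(k22 (xchg f _)).
by rewrite (w22 _ (modhom_h g W)).
Defined.

End TensorMor.

Definition regA : rmodule A := RModule (mulA A) (mulm1 A).

Lemma lact_regA : lact regA = mul A.
Proof. exact: mulC. Qed.

Section Unitors.
Variable M : rmodule A.

Lemma luA_bal : balanced (M := regA) (N := M) (lact M).
Proof. by apply: balancedP => W; rewrite /= hl_assoc. Qed.
Definition luA_h : hom (tenA regA M) M := bdesc luA_bal.
Lemma luA_hE W : (luA_h ▷ W) ∘ h21 (qA regA M) W = h21 (lact M) W.
Proof. exact: bdesc_h. Qed.
Definition luA : modhom (tenA regA M) M.
Proof.
exists luA_h; apply: modhomP => W; apply: (epi_hq (M := regA)); rewrite !compA.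
by rewrite (tenA_act_h regA M W) (k21 (luA_hE _)) luA_hE -hl_ha.
Defined.
Definition luiA_h : hom M (tenA regA M) := qA regA M ∘ (eta A ▷ M) ∘ lui M.
Lemma luiA_hE W :
  luiA_h ▷ W = h21 (qA regA M) W ∘ h01 (eta A) (M ⊗ W).
Proof.
rewrite !wr_comp h21E wr_wr lui_wr !compA !(k20 (asciK _ _ _)).
by rewrite h01_def.
Qed.
Definition luiA : modhom M (tenA regA M).
Proof.
exists luiA_h; apply: modhomP => W; rewrite !luiA_hE !compA h01_nat.
by rewrite (k22 (tenA_act_h regA M W)).
Defined.

Lemma ruA_bal : balanced (M := M) (N := regA) (act M).
Proof.
by apply: balancedP => W; rewrite /= lact_regA ha_assoc.
Qed.
Definition ruA_h : hom (tenA M regA) M := bdesc ruA_bal.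
Lemma ruA_hE W : (ruA_h ▷ W) ∘ h21 (qA M regA) W = h21 (act M) W.
Proof. exact: bdesc_h. Qed.
Definition ruA : modhom (tenA M regA) M.
Proof.
exists ruA_h; apply: modhomP => W; apply: (epi_hq (M := M)); rewrite !compA.
by rewrite (tenA_act_h M regA W) (k21 (ruA_hE _)) ruA_hE -ha_assoc.
Defined.
Definition ruiA_h : hom M (tenA M regA) := qA M regA ∘ (M ◁ eta A) ∘ rui M.
Lemma ruiA_hE W :
  ruiA_h ▷ W = h21 (qA M regA) W ∘ (M ◁ h01 (eta A) W).
Proof.
rewrite !wr_comp h21E wl_wr rui_wr !compA !(k20 (asciK _ _ _)).
by rewrite h01_def wl_comp.
Qed.
Definition ruiA : modhom M (tenA M regA).
Proof.
exists ruiA_h; apply: modhomP => W; rewrite !ruiA_hE !compA.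
rewrite (k22 (tenA_act_h M regA W)) /= (w20 M (hm_1l _)) compm1.
rewrite -h21_nat (k22 (hq_bal M regA W)) lact_regA.
by rewrite (w20 M (hm_1r _)) compm1.
Defined.

Lemma luAK : rmod_comp luiA luA = rmod_id (tenA regA M).
Proof.
apply/modhom_eq/wfaith => W /=; apply: (epi_hq (M := regA)).
rewrite wr_comp tenm_id comp1m compA luA_hE luiA_hE compA h01_nat.
by rewrite -(k22 (hq_bal regA M W)) hm_1l compm1.
Qed.
Lemma luiAK : rmod_comp luA luiA = rmod_id M.
Proof.
apply/modhom_eq/wfaith => W /=.
by rewrite wr_comp luiA_hE (k21 (luA_hE W)) hl_1 tenm_id.
Qed.
Lemma ruAK : rmod_comp ruiA ruA = rmod_id (tenA M regA).
Proof.
apply/modhom_eq/wfaith => W /=; apply: (epi_hq (M := M)).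
rewrite wr_comp tenm_id comp1m compA ruA_hE ruiA_hE compA -h21_nat.
by rewrite (k22 (hq_bal M regA W)) lact_regA (w20 M (hm_1r _)) compm1.
Qed.
Lemma ruiAK : rmod_comp ruA ruiA = rmod_id M.
Proof.
apply/modhom_eq/wfaith => W /=.
by rewrite wr_comp ruiA_hE (k21 (ruA_hE W)) ha_1 tenm_id.
Qed.

End Unitors.

Section Associator.
Variables M N P : rmodule A.
Let T := tenA M N.
Let S := tenA N P.

Lemma epi_qMS W : epi (h21 (qA M S) W ∘ (M ◁ h21 (qA N P) W)).
Proof.
apply: epi_comp; first exact: epi_hq.
by apply: epi_wl; [exact: ld R _ | exact: epi_hq].
Qed.
Lemma epi_qTP W : epi (h21 (qA T P) W ∘ h21 (qA M N) (P ⊗ W)).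
Proof. by apply: epi_comp; apply: epi_hq. Qed.

Lemma ascA_aux1 :
  (qA M S ∘ (M ◁ qA N P) ∘ asc M N P) ∘ ((act M ▷ N) ▷ P) =
  (qA M S ∘ (M ◁ qA N P) ∘ asc M N P) ∘ (((M ◁ lact N) ∘ asc M A N) ▷ P).
Proof.
apply: h41_inj => W; rewrite h41_wr h41_mid h31_wl !compA.
rewrite -(h21_nat (act M)) (k22 (hq_bal M S W)).
by rewrite (w22 M (tenA_lact_h N P W)).
Qed.
Definition ascA_pre : hom (T ⊗ P) (tenA M S) :=
  cq_desc (coeqR (ld R P) (tenA_coeq M N)) ascA_aux1.
Lemma ascA_pre_h W :
  h21 ascA_pre W ∘ h21 (qA M N) (P ⊗ W) = h21 (qA M S) W ∘ (M ◁ h21 (qA N P) W).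
Proof.
rewrite -h31_wr -h31_wl; apply: (congr1 (fun f => h31 f W)).
exact: (cq_descE (coeqR (ld R P) (tenA_coeq M N)) ascA_aux1).
Qed.
Lemma ascA_bal : balanced (M := T) (N := P) ascA_pre.
Proof.
apply: balancedP => W; apply: (@epi_hq M N); rewrite !compA.
rewrite (tenA_act_h M N _) (k22 (ascA_pre_h _)) -h21_nat (k22 (ascA_pre_h _)).
by rewrite (w22 M (hq_bal N P W)).
Qed.
Definition ascA_h : hom (tenA T P) (tenA M S) := bdesc ascA_bal.
Lemma ascA_hE W :
  (ascA_h ▷ W) ∘ h21 (qA T P) W ∘ h21 (qA M N) (P ⊗ W) =
  h21 (qA M S) W ∘ (M ◁ h21 (qA N P) W).
Proof. by rewrite (k21 (bdesc_h ascA_bal W)) ascA_pre_h. Qed.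
Definition ascA : modhom (tenA T P) (tenA M S).
Proof.
exists ascA_h; apply: modhomP => W; apply: (@epi_qTP (A ⊗ W)).
rewrite !compA.
rewrite (k22 (tenA_act_h T P W)) -h21_nat ascA_hE.
rewrite (k31 (ascA_hE W)) (k22 (tenA_act_h M S W)).
by rewrite (w22 M (tenA_act_h N P W)) !compA.
Defined.

Lemma asciA_aux1 :
  (qA T P ∘ (qA M N ▷ P) ∘ asci M N P) ∘ (M ◁ (act N ▷ P)) =
  (qA T P ∘ (qA M N ▷ P) ∘ asci M N P) ∘ (M ◁ ((N ◁ lact P) ∘ asc N A P)).
Proof.
apply: h41r_inj => W; rewrite h41r_wr h41r_mid h31r_wr !compA.
rewrite -(tenA_act_h M N _) (k22 (hq_bal T P W)).
by rewrite h21_nat.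
Qed.
Definition asciA_pre : hom (M ⊗ S) (tenA T P) :=
  cq_desc (coeqL (ld R M) (tenA_coeq N P)) asciA_aux1.
Lemma asciA_pre_h W :
  h21 asciA_pre W ∘ (M ◁ h21 (qA N P) W) = h21 (qA T P) W ∘ h21 (qA M N) (P ⊗ W).
Proof.
rewrite -h31r_wr -h31r_wl; apply: (congr1 (fun f => h31r f W)).
exact: (cq_descE (coeqL (ld R M) (tenA_coeq N P)) asciA_aux1).
Qed.
Lemma asciA_bal : balanced (M := M) (N := S) asciA_pre.
Proof.
apply: balancedP => W.
have e : epi (M ◁ (A ◁ h21 (qA N P) W)).
  by do 2![apply: epi_wl; first exact: ld R _]; apply: epi_hq.
apply: e; rewrite !compA h21_nat (k22 (asciA_pre_h _)).
rewrite (w22 M (tenA_lact_h N P W)) (k22 (asciA_pre_h _)).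
by rewrite (hq_bal M N).
Qed.
Definition asciA_h : hom (tenA M S) (tenA T P) := bdesc asciA_bal.
Lemma asciA_hE W :
  (asciA_h ▷ W) ∘ h21 (qA M S) W ∘ (M ◁ h21 (qA N P) W) =
  h21 (qA T P) W ∘ h21 (qA M N) (P ⊗ W).
Proof. by rewrite (k21 (bdesc_h asciA_bal W)) asciA_pre_h. Qed.

Definition asciA : modhom (tenA M S) (tenA T P).
Proof.
exists asciA_h; apply: modhomP => W; apply: (@epi_qMS (A ⊗ W)); rewrite !compA.
rewrite (k22 (tenA_act_h M S W)) (w22 M (tenA_act_h N P W)).
rewrite (k31 (asciA_hE W)) asciA_hE !compA.
by rewrite (k22 (tenA_act_h T P W)) h21_nat.
Defined.

Lemma ascAK : rmod_comp asciA ascA = rmod_id (tenA T P).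
Proof.
apply/modhom_eq/wfaith => W /=; apply: epi_qTP.
by rewrite wr_comp compA ascA_hE asciA_hE tenm_id comp1m.
Qed.
Lemma asciAK : rmod_comp ascA asciA = rmod_id (tenA M S).
Proof.
apply/modhom_eq/wfaith => W /=; apply: epi_qMS.
by rewrite wr_comp compA asciA_hE ascA_hE tenm_id comp1m.
Qed.

End Associator.

Definition rmod_mon : monoidal.
Proof.
refine (@Monoidal rmod_cat tenA regA tenA_mor _ _ ascA asciA ascAK asciAK _
  luA luiA luAK luiAK _ ruA ruiA ruAK ruiAK _ _ _).
- move=> M N; apply/modhom_eq/epi_qA => /=.
  by rewrite tenA_mhE /= tenm_id comp1m compm1.
- move=> M M' M'' N N' N'' f' f g' g; apply/modhom_eq/epi_qA => /=.
  by rewrite compA !tenA_mhE (k22 (tenA_mhE _ _)) /= tenm_comp.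
- move=> M M' N N' P P' f g h; apply/modhom_eq/wfaith => W /=.
  apply: epi_qTP; rewrite !wr_comp !compA.
  rewrite ascA_hE (k23 (tenA_mh_h _ _ _)) (k23 (tenA_mh_h _ _ _)) /=.
  rewrite -(h21_nat (qA M N)) (k23 (tenA_mh_h _ _ _)) (k31 (ascA_hE _ _ _ _)) !compA.
  by rewrite (w23 M (tenA_mh_h g h W)) -(k22 (xchg f _)).
- move=> M N f; apply/modhom_eq/wfaith => W /=.
  apply: epi_hq; rewrite !wr_comp !compA tenA_mh_h /= tenm_id comp1m.
  by rewrite (k21 (luA_hE _ _)) luA_hE modhom_hl.
- move=> M N f; apply/modhom_eq/wfaith => W /=.
  apply: epi_hq; rewrite !wr_comp !compA tenA_mh_h /= !tenm_id compm1.
  by rewrite (k21 (ruA_hE _ _)) ruA_hE modhom_h.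
- move=> M N P S; apply/modhom_eq/wfaith => W /=.
  apply: epi_hq; apply: epi_hq; apply: epi_hq; rewrite !wr_comp !compA.
  rewrite (k31 (ascA_hE (tenA M N) P S W)) !compA -(h21_nat (qA M N)).
  rewrite (k31 (ascA_hE M N (tenA P S) W)) !compA.
  rewrite (k23 (tenA_mh_h (ascA M N P) (rmod_id S) W)) /= !tenm_id comp1m.
  rewrite (ascA_hE M N P) (k31 (ascA_hE M (tenA N P) S W)) !compA.
  rewrite (k23 (tenA_mh_h (rmod_id M) (ascA N P S) W)) /= !tenm_id comp1m.
  by rewrite -!wl_comp ascA_hE.
- move=> M N; apply/modhom_eq/wfaith => W /=.
  apply: epi_qTP; rewrite !wr_comp !compA ascA_hE.
  rewrite (k23 (tenA_mh_h (rmod_id M) (luA N) W)).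
  rewrite (k23 (tenA_mh_h (ruA M) (rmod_id N) W)) /= !tenm_id !comp1m.
  by rewrite -wl_comp luA_hE ruA_hE hq_bal.
Defined.

End Modules.

Section FullSubcategory.
Variables (C : monoidal) (S : C -> Prop).
Hypothesis S_one : S one.
Hypothesis S_ten : forall X Y : C, S X -> S Y -> S (X ⊗ Y).

Record full_ob := FullOb { fob :> C; fobP : S fob }.

Definition full_cat : category :=
  @Category full_ob (fun X Y => hom (fob X) (fob Y)) (fun X => idm (fob X))
    (fun X Y Z f g => f ∘ g) (fun X Y => @comp1m C X Y)
    (fun X Y => @compm1 C X Y) (fun X Y Z W => @compA C X Y Z W).

Definition full_one : full_cat := FullOb S_one.
Definition full_ten (X Y : full_cat) : full_cat := FullOb (S_ten (fobP X) (fobP Y)).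

Definition full_mon : monoidal :=
  @Monoidal full_cat full_ten full_one (fun X X' Y Y' f g => tenm f g)
    (fun X Y => tenm_id (fob X) (fob Y))
    (fun X X' X'' Y Y' Y'' => @tenm_comp C X X' X'' Y Y' Y'')
    (fun X Y Z => asc (fob X) (fob Y) (fob Z))
    (fun X Y Z => asci (fob X) (fob Y) (fob Z))
    (fun X Y Z => ascK (fob X) (fob Y) (fob Z))
    (fun X Y Z => asciK (fob X) (fob Y) (fob Z))
    (fun X X' Y Y' Z Z' => @asc_nat C X X' Y Y' Z Z')
    (fun X => lu (fob X)) (fun X => lui (fob X))
    (fun X => luK (fob X)) (fun X => luiK (fob X)) (fun X Y => @lu_nat C X Y)
    (fun X => ru (fob X)) (fun X => rui (fob X))
    (fun X => ruK (fob X)) (fun X => ruiK (fob X)) (fun X Y => @ru_nat C X Y)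
    (fun X Y Z W => pentagon (fob X) (fob Y) (fob Z) (fob W))
    (fun X Y => triangle (fob X) (fob Y)).

End FullSubcategory.

Section LocalModules.
Variables (C : braided) (R : rigid C) (Q : has_coequalizers C).
Variable A : comAlgebra C.
Implicit Types (M N P : rmodule A) (W X Y Z : C).

Local Notation tenA := (tenA R Q).
Local Notation qA := (qA Q).
Local Notation epi_hq := (epi_hq R (Q := Q)).
Local Notation tenA_act_h := (tenA_act_h R Q).

Lemma loc_h M W : is_local M ->
  h21 (act M) W ∘ hb A M W ∘ hb M A W = h21 (act M) W.
Proof. by move=> H; rewrite -{2}H !h21_comp2 h22_comp. Qed.
Lemma localP M :
  (forall W, h21 (act M) W ∘ hb A M W ∘ hb M A W = h21 (act M) W) -> is_local M.
Proof. by move=> H; apply: h21_inj => W; rewrite !h21_comp2 h22_comp. Qed.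

Lemma regA_local : is_local (regA A).
Proof. by rewrite /is_local /= -compA !mulC. Qed.

Lemma tenA_local M N : is_local M -> is_local N -> is_local (tenA M N).
Proof.
move=> lM lN; apply: localP => W; apply: (epi_hq (M := M) (N := N)).
rewrite !compA (hb_l A (qA M N)) (k23 (hb_r A (qA M N) W)).
rewrite (k22 (tenA_act_h M N W)) tenA_act_h.
rewrite (k21 (w21 M (esym (hlE N W)))) -(k22 (hq_bal Q M N W)).
rewrite (k31 (loc_h _ lM)) (k22 (hq_bal Q M N W)) hlE.
by rewrite -wl_comp compA loc_h.
Qed.

Definition loc_mon : monoidal :=
  full_mon (C := rmod_mon R Q A) regA_local tenA_local.

Section Braiding.
Variables M N : rmodule A.
Hypothesis lM : is_local M.

(* The braiding of local modules exists as soon as the first one is local. *)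
Lemma brA_key W :
  h21 (qA N M) W ∘ h21 (act N) (M ⊗ W) ∘ (N ◁ hb M A W) =
  h21 (qA N M) W ∘ (N ◁ h21 (act M) W).
Proof.
by rewrite (k22 (hq_bal Q N M W)) -wl_comp hlE compA loc_h.
Qed.

Lemma brA_bal : balanced (qA N M ∘ br M N).
Proof.
apply: balancedP => W; rewrite !(h21_comp2 (qA N M)) -/(hb M N W) !compA hb_l.
rewrite hlE wl_comp (k23 (hb_r M (act N) W)) (k31 (brA_key W)).
by rewrite !compA.
Qed.
Definition brA_h : hom (tenA M N) (tenA N M) := bdesc Q brA_bal.
Lemma brA_hE0 : brA_h ∘ qA M N = qA N M ∘ br M N.
Proof. exact: bdescE. Qed.
Lemma brA_hE W : (brA_h ▷ W) ∘ h21 (qA M N) W = h21 (qA N M) W ∘ hb M N W.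
Proof. by rewrite bdesc_h h21_comp2. Qed.
Definition brA : modhom (tenA M N) (tenA N M).
Proof.
exists brA_h; apply: modhomP => W; apply: (epi_hq (M := M) (N := N)); rewrite !compA.
rewrite (tenA_act_h M N W) (k22 (brA_hE _)) brA_hE (k22 (tenA_act_h N M W)).
by rewrite (hb_r M (act N) W) (k31 (brA_key W)) !compA.
Defined.

Lemma briA_key W :
  h21 (qA M N) W ∘ hbi M N W ∘ (N ◁ h21 (act M) W) =
  h21 (qA M N) W ∘ (M ◁ h21 (act N) W) ∘ hbi M N (A ⊗ W).
Proof.
rewrite (hbi_l N (act M) W) (k22 (hq_bal Q M N W)) hlE wl_comp !compA.
by rewrite (k20 (w20 M (hbiK _ _ _))).
Qed.
Lemma briA_bal : balanced (qA M N ∘ bri M N).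
Proof.
apply: balancedP => W; rewrite !(h21_comp2 (qA M N)) -/(hbi M N W) !compA hbi_r.
rewrite (k31 (esym (briA_key W))) !compA -!wl_comp hlE.
by rewrite -{1}(loc_h W lM) !compA hbiK compm1.
Qed.
Definition briA_h : hom (tenA N M) (tenA M N) := bdesc Q briA_bal.
Lemma briA_hE0 : briA_h ∘ qA N M = qA M N ∘ bri M N.
Proof. exact: bdescE. Qed.
Lemma brAK_h : briA_h ∘ brA_h = idm _.
Proof.
apply: epi_qA.
by rewrite compA brA_hE0 (k22 briA_hE0) brK compm1 comp1m.
Qed.
Lemma briAK_h : brA_h ∘ briA_h = idm _.
Proof.
apply: epi_qA.
by rewrite compA briA_hE0 (k22 brA_hE0) briK compm1 comp1m.
Qed.
Definition briA : modhom (tenA N M) (tenA M N).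
Proof.
exists briA_h.
by rewrite -[LHS]compm1 -(r20 A briAK_h) compA -(k22 (mhP brA)) (k20 brAK_h).
Defined.
Lemma brAK : rmod_comp briA brA = rmod_id _.
Proof. exact/modhom_eq/brAK_h. Qed.
Lemma briAK : rmod_comp brA briA = rmod_id _.
Proof. exact/modhom_eq/briAK_h. Qed.

End Braiding.

Section Hexagons.
Variables (M M' N N' P : rmodule A).
Hypotheses (lM : is_local M) (lM' : is_local M') (lN : is_local N).

Lemma brA_nat (f : modhom M M') (g : modhom N N') :
  rmod_comp (brA N' lM') (tenA_mor R Q f g) =
  rmod_comp (tenA_mor R Q g f) (brA N lM).
Proof.
apply/modhom_eq/epi_qA => /=; rewrite !compA tenA_mhE brA_hE0.
by rewrite (k22 (brA_hE0 _ _)) (k22 (tenA_mhE _ _ _)) br_nat.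
Qed.

Lemma brA_hex1 :
  rmod_comp (ascA R Q N P M) (rmod_comp (brA (tenA N P) lM) (ascA R Q M N P)) =
  rmod_comp (tenA_mor R Q (rmod_id N) (brA P lM))
    (rmod_comp (ascA R Q N M P) (tenA_mor R Q (brA N lM) (rmod_id P))).
Proof.
apply/modhom_eq/wfaith => W /=.
apply: epi_qTP; rewrite !wr_comp !compA ascA_hE (k22 (brA_hE _ _ _)).
rewrite (hb_r M (qA N P) W) (k31 (ascA_hE R Q N P M W)) !compA.
rewrite (k23 (tenA_mh_h Q (brA N lM) (rmod_id P) W)) /=.
rewrite !tenm_id comp1m (brA_hE N lM).
rewrite (k31 (ascA_hE R Q N M P W)) !compA.
rewrite (k23 (tenA_mh_h Q (rmod_id N) (brA P lM) W)) /=.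
by rewrite !tenm_id comp1m (k22 (w22 _ (brA_hE P lM W))).
Qed.

Lemma brA_hex2 :
  rmod_comp (asciA R Q P M N)
    (rmod_comp (brA P (tenA_local lM lN)) (asciA R Q M N P)) =
  rmod_comp (tenA_mor R Q (brA P lM) (rmod_id N))
    (rmod_comp (asciA R Q M P N) (tenA_mor R Q (rmod_id M) (brA P lN))).
Proof.
apply/modhom_eq/wfaith => W /=.
apply: epi_qMS; rewrite !wr_comp !compA asciA_hE (k22 (brA_hE _ _ _)).
rewrite (hb_l P (qA M N) W) (k31 (asciA_hE R Q P M N W)) !compA.
rewrite (k23 (tenA_mh_h Q (rmod_id M) (brA P lN) W)) /=.
rewrite !tenm_id comp1m (w22 _ (brA_hE P lN W)).
rewrite (k31 (asciA_hE R Q M P N W)) !compA.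
rewrite (k23 (tenA_mh_h Q (brA P lM) (rmod_id N) W)) /=.
by rewrite !tenm_id comp1m (k22 (brA_hE P lM _)).
Qed.

End Hexagons.

Local Notation loc_ob := (@full_ob (rmod_mon R Q A) (@is_local C A)).

Definition loc_br : braided :=
  @Braided loc_mon (fun M N : loc_ob => brA (fob N) (fobP M))
    (fun M N : loc_ob => briA (fob N) (fobP M))
    (fun M N : loc_ob => brAK (fob N) (fobP M))
    (fun M N : loc_ob => briAK (fob N) (fobP M))
    (fun M M' N N' : loc_ob => brA_nat (fobP M) (fobP M'))
    (fun M N P : loc_ob => brA_hex1 (fob N) (fob P) (fobP M))
    (fun M N P : loc_ob => brA_hex2 (fob P) (fobP M) (fobP N)).

Variable th : twist C.
Hypothesis thA : th A = idm A.

Lemma tw_modP M : is_local M -> th M ∘ act M = act M ∘ (th M ▷ A).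
Proof.
move=> lM; rewrite tw_nat tw_ten thA -(k22 (br_nat (idm A) (th M))).
by rewrite -(br_nat (th M) (idm A)) (k31 lM).
Qed.

Lemma twi_modP M : is_local M -> twi th M ∘ act M = act M ∘ (twi th M ▷ A).
Proof.
move=> lM; rewrite -[LHS]compm1 -(r20 A (twiK th M)) compA.
by rewrite -(k22 (tw_modP lM)) (k20 (twK _ _)).
Qed.

Lemma tw_tenA M N (lM : is_local M) (lN : is_local N) :
  ModHom (tw_modP (tenA_local lM lN)) =
  rmod_comp (tenA_mor R Q (ModHom (tw_modP lM)) (ModHom (tw_modP lN)))
    (rmod_comp (brA M lN) (brA N lM)).
Proof.
apply/modhom_eq/epi_qA => /=; rewrite tw_nat tw_ten !compA brA_hE0.
by rewrite (k22 (brA_hE0 _ _)) (k22 (tenA_mhE _ _ _)).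
Qed.

Definition loc_twist : twist loc_br.
Proof.
refine (@Twist loc_br (fun M : loc_ob => ModHom (tw_modP (fobP M)))
  (fun M : loc_ob => ModHom (twi_modP (fobP M))) _ _ _ _).
- by move=> M; apply: modhom_eq; apply: twK.
- by move=> M; apply: modhom_eq; apply: twiK.
- by move=> M N f; apply: modhom_eq; apply: tw_nat.
- by move=> M N; apply: tw_tenA.
Defined.

End LocalModules.

Section DualAlgebra.
Variables (C : braided) (R : rigid C) (A : comAlgebra C).

Local Notation D := (ld R A).

(* (id ⊗ ev_A) ∘ (μ^* ⊗ id_A), with μ^* formed along (A ⊗ A)^* = A^* ⊗ A^*. *)
Definition DA_act : hom (D ⊗ A) D :=
  ru D ∘ (D ◁ ev D) ∘ asc D D A ∘ (dualm (ten_dual D D) D (mul A) ▷ A).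

Lemma dualm_wr (X Y : C) (DX : leftDual X) (DY : leftDual Y) (f : hom X Y) W :
  dualm DX DY f ▷ W =
  h20 (ev DY) (DX ⊗ W) ∘ (DY ◁ (f ▷ (DX ⊗ W))) ∘ (DY ◁ h02 (coev DX) W).
Proof.
rewrite !wr_comp lu_wr wr_wr asci_wr !wl_wr rui_wr wr_wr ?compA.
rewrite !(k20 (asciK _ _ _)) !wl_comp ?compA (k20 (w20 _ (asciK _ _ _))).
by rewrite h20_def h02_def !wl_comp ?compA.
Qed.

Lemma dualm_ev (X Y : C) (DX : leftDual X) (DY : leftDual Y) (f : hom X Y) W :
  h20 (ev DX) W ∘ (dualm DX DY f ▷ (X ⊗ W)) = h20 (ev DY) W ∘ (DY ◁ (f ▷ W)).
Proof.
rewrite dualm_wr -(k22 (h20_nat (ev DY) (h20 (ev DX) W))) -!wl_comp.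
by rewrite -(k22 (xchg f _)) zz1h compm1.
Qed.

Lemma dualm_id (X : C) (DX : leftDual X) : dualm DX DX (idm X) = idm DX.
Proof. by rewrite /dualm !tenm_id comp1m; exact: ldual_zz2. Qed.

Lemma dual_inj (X Y : C) (DY : leftDual Y) (u v : hom X DY) :
  (forall W, h20 (ev DY) W ∘ (u ▷ (Y ⊗ W)) = h20 (ev DY) W ∘ (v ▷ (Y ⊗ W))) ->
  u = v.
Proof.
move=> H; apply: wfaith => W.
rewrite -[u ▷ W]comp1m -[v ▷ W]comp1m -(zz2h DY W) ?compA -!xchg.
by rewrite -?compA H.
Qed.

Lemma ten_ev_h (X Y : C) (DX : leftDual X) (DY : leftDual Y) W :
  h20 (ten_ev DX DY) W = h20 (ev DY) W ∘ (DY ◁ h20 (ev DX) (Y ⊗ W)) ∘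
    asc DY DX (X ⊗ (Y ⊗ W)) ∘ ((DY ⊗ DX) ◁ asc X Y W).
Proof.
rewrite [LHS]h20_def ten_evE !wr_comp wl_wr asc_wr h20_wr !wl_comp ?compA.
rewrite !(k20 (asciK _ _ _)) asciK compm1 (h20E (ev DY)) ?compA.
rewrite (k20 (luiK _)) !(k20 (asciK _ _ _)) (k20 (w20 _ (asciK _ _ _))).
by rewrite wl_ten ?compA (k20 (asciK _ _ _)).
Qed.

Lemma DA_act_h W :
  h21 DA_act W = (D ◁ h20 (ev D) W) ∘ asc D D (A ⊗ W) ∘
    (dualm (ten_dual D D) D (mul A) ▷ (A ⊗ W)).
Proof.
rewrite h21_def /DA_act; move: (dualm _ _ _) => /= m.
rewrite !wr_comp ru_wr wl_wr asc_wr wr_wr ?compA.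
by rewrite !(k20 (asciK _ _ _)) asciK compm1 h20_def !wl_comp ?compA.
Qed.

Lemma DA_act_ev W :
  h20 (ev D) W ∘ h21 DA_act (A ⊗ W) = h20 (ev D) W ∘ (D ◁ h21 (mul A) W).
Proof.
have := dualm_ev (ten_dual D D) D (mul A) W.
rewrite DA_act_h; move: (dualm _ _ _) => /= m H.
rewrite h21_def wl_comp (k22 (esym H)) ten_ev_h ?compA.
by rewrite (xchg m) (k20 (w20 _ (asciK _ _ _))).
Qed.

Lemma DA_actA :
  DA_act ∘ (DA_act ▷ A) = DA_act ∘ (D ◁ mul A) ∘ asc D A A.
Proof.
move: DA_act DA_act_ev => a aE; apply: (dual_inj (DY := D)) => W.
have e : epi (asci (D ⊗ A) A (A ⊗ W) ∘ asci D A (A ⊗ (A ⊗ W))).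
  by apply: epi_comp; apply: (epi_iso (ascK _ _ _)).
apply: e; rewrite ?compA -!h31_def h31_wr h31_wl.
rewrite !(k22 (aE W)) -(h21_nat a) (k22 (aE W)).
by rewrite (w22 D (hm_assoc A W)).
Qed.

Lemma DA_act1 : DA_act ∘ (D ◁ eta A) = ru D.
Proof.
move: DA_act DA_act_ev => a aE; apply: (dual_inj (DY := D)) => W.
rewrite wr_comp wl_wr ru_wr h01E wl_comp ?compA.
rewrite (k21 (esym (h21_def a (A ⊗ W)))) (k22 (aE W)).
by rewrite (k20 (w20 D (hm_1l A W))).
Qed.

Definition DA : rmodule A := RModule DA_actA DA_act1.

End DualAlgebra.

Lemma DA_local (C : ribbon) (A : comAlgebra C) :
  rtw C A = idm A -> is_local (DA (rrig C) A).
Proof.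
move=> thA; set M := DA _ _.
have thD : rtw C M = idm M.
  by rewrite -[LHS](rribbon (r := C)) thA dualm_id.
rewrite /is_local -[RHS]comp1m -thD tw_nat tw_ten thD thA tenm_id comp1m.
by [].
Qed.

Definition DA_loc (C : ribbon) (Q : has_coequalizers C) (A : comAlgebra C)
    (thA : rtw C A = idm A) : loc_br (rrig C) Q A :=
  FullOb (DA_local thA).

(* Main.v *)
(** Write [E] for D(A), whose counit [E -> 1] evaluates a functional at the unit
    of [A]. A module map into [E] is determined by its composite with the counit,
    so the ribbon identity of [C] gives [G (θ_X ⊗ 1) = G (1 ⊗ θ_M)] for every
    [E]-valued pairing [G] of local modules. Apply this to
    [G = E ⊗ ev : (E ⊗ V) ⊗ M -> E], where [V] is a left dual of [M]: since
    [θ_E = 1], the twist of [E ⊗ V] is [E ⊗ θ_V] up to the double braiding of [E]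
    and [V]. Hence the double braiding is trivial iff [E ⊗ -] identifies
    [ev (θ_V ⊗ 1)] with [ev (1 ⊗ θ_M)], and [E ⊗ -] is faithful on maps to the
    unit [A] because the evaluation of [A] in [C] is nondegenerate. *)
From mathcomp Require Import ssreflect ssrfun.
Require Import Defs.

Set Implicit Arguments.
Unset Strict Implicit.
Unset Printing Implicit Defensive.

Local Open Scope cat_scope.

Section Pairings.
Variable C : braided.
Implicit Types X Y Z W : C.

Lemma h20_inj X Y (f g : hom (X ⊗ Y) one) :
  (forall W, h20 f W = h20 g W) -> f = g.
Proof. by move=> H; apply: wfaith => W; rewrite !h20E H. Qed.

Lemma h20_tenwr X X' Y (f : hom (X' ⊗ Y) one) (g : hom X X') W :
  h20 (f ∘ (g ▷ Y)) W = h20 f W ∘ (g ▷ (Y ⊗ W)).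
Proof. by rewrite !h20_def wr_comp wr_wr !compA asciK compm1. Qed.

Lemma h20_tenwl X Y Y' (f : hom (X ⊗ Y') one) (g : hom Y Y') W :
  h20 (f ∘ (X ◁ g)) W = h20 f W ∘ (X ◁ (g ▷ W)).
Proof. by rewrite !h20_def wr_comp wl_wr !compA asciK compm1. Qed.

Lemma ev_dualm X Y (DX : leftDual X) (DY : leftDual Y) (f : hom X Y) :
  ev DX ∘ (dualm DX DY f ▷ X) = ev DY ∘ (DY ◁ f).
Proof. by apply: h20_inj => W; rewrite h20_tenwr h20_tenwl dualm_ev. Qed.

Lemma ev_injl X Y (DY : leftDual Y) (u v : hom X DY) :
  ev DY ∘ (u ▷ Y) = ev DY ∘ (v ▷ Y) -> u = v.
Proof. by move=> H; apply: dual_inj => W; rewrite -!h20_tenwr H. Qed.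

Lemma ev_injr X Y (DY : leftDual Y) (u v : hom X Y) :
  ev DY ∘ (DY ◁ u) = ev DY ∘ (DY ◁ v) -> u = v.
Proof.
move=> H; apply: wfaith => W.
rewrite -[u ▷ W]comp1m -[v ▷ W]comp1m -(zz1h DY W) !compA !h02_nat.
by rewrite -!(compA (Y ◁ _)) -!wl_comp -!h20_tenwl H.
Qed.

Lemma untrK W (D : leftDual W) Y Z (t : hom Y (Z ⊗ D)) : tr D (untr t) = t.
Proof.
rewrite /untr /tr !wr_comp ru_wr wl_wr asc_wr !wr_wr !compA.
rewrite !(k20 (asciK _ _ _)).
rewrite (k22 (xchg t _)) -rui_nat rui_ten wl_ten !compA.
rewrite !(k20 (asciK _ _ _)).
have := congr1 (fun u => (Z ◁ u) ∘ t) (ldual_zz2 D).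
by rewrite !wl_comp tenm_id comp1m !compA.
Qed.

Lemma untr_inj W (D : leftDual W) Y Z (s t : hom Y (Z ⊗ D)) :
  untr s = untr t -> s = t.
Proof. by move=> H; rewrite -(untrK s) H untrK. Qed.

Lemma lu_one : lu (one : C) = ru one.
Proof. by apply: wfaith => W; rewrite lu_wr ru_wr wl_lu. Qed.

Lemma pairing_factor X W (D : leftDual W) (p : hom (X ⊗ W) one) :
  exists t : hom X D, p = ev D ∘ (t ▷ W).
Proof.
(* The witness is the transpose of [p], with the unit factor removed. *)
exists (lu D ∘ tr D p); rewrite -{1}(trK D p) /untr wr_comp lu_wr !compA.
by rewrite (k22 (esym (lu_nat (ev D)))) lu_one.
Qed.

End Pairings.

Section RibbonPairings.
Variables (C : braided) (R : rigid C) (th : twist C).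

(** By [pairing_factor], [p] is [ev] after a map [t] into the dual of [Y]; naturality carries the
    twist across [t], and the ribbon identity transposes it onto [Y]. *)
Lemma ribbon_pairing (X Y : C) (p : hom (X ⊗ Y) one) :
  is_ribbon R th -> p ∘ (th X ▷ Y) = p ∘ (X ◁ th Y).
Proof.
move=> rib; have [t ->] := pairing_factor (ld R Y) p.
rewrite !compA -wr_comp -tw_nat wr_comp -rib (k22 (ev_dualm _ _ _)).
by rewrite xchg.
Qed.

Lemma is_ribbon_ev :
  (forall X : C, ev (ld R X) ∘ (th (ld R X) ▷ X) =
     ev (ld R X) ∘ (ld R X ◁ th X)) ->
  is_ribbon R th.
Proof. by move=> H X; apply: ev_injl; rewrite ev_dualm H. Qed.

End RibbonPairings.

Section Dualizing.
Variables (C : braided) (R : rigid C) (th : twist C) (E : C).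
Hypothesis thE : th E = idm E.
Hypothesis E_pairing : forall (X Y : C) (G : hom (X ⊗ Y) E),
  G ∘ (th X ▷ Y) = G ∘ (X ◁ th Y).
Hypothesis E_faithful : forall (X : C) (u v : hom X one),
  E ◁ u = E ◁ v -> u = v.

Lemma untr_wl (X : C) (D : leftDual X) (f : hom D D) :
  untr (E ◁ f) = ru E ∘ (E ◁ (ev D ∘ (f ▷ X))) ∘ asc E D X.
Proof. by rewrite /untr asc_nat wl_comp !compA. Qed.

(** [E_pairing], applied to [untr] of the identity, moves the twist of [E ⊗ D] onto [X]. *)
Lemma untr_tw (X : C) (D : leftDual X) :
  untr (th (E ⊗ D)) = ru E ∘ (E ◁ (ev D ∘ (D ◁ th X))) ∘ asc E D X.
Proof.
rewrite -[th _]comp1m untr_nat E_pairing /untr tenm_id compm1.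
by rewrite wl_ten !compA (k20 (asciK _ _ _)) wl_comp !compA.
Qed.

(** By [thE], the twist of [E ⊗ X] is [E ◁ th X] after the double braiding, and [th X] is
    invertible. *)
Lemma tw_central (X : C) :
  th (E ⊗ X) = E ◁ th X <-> br X E ∘ br E X = idm (E ⊗ X).
Proof.
rewrite tw_ten thE; split=> [H | ->]; last by rewrite compm1.
by rewrite -[LHS](k20 (w20 E (twK th X))) H (w20 E (twK th X)).
Qed.

Lemma ribbon_iff_Mueger : is_ribbon R th <-> Mueger_center E.
Proof.
split=> [rib Y | cE].
  apply/tw_central.
  (* Every [Y] is a left dual, namely of its right dual, so endomorphisms of [E ⊗ Y] can be compared
     after [untr]. *)
  pose D := LeftDual (rdual_zz1 (rd R Y)) (rdual_zz2 (rd R Y)).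
  apply: (untr_inj (D := D)).
  by rewrite (untr_tw D) (untr_wl (D := D)) (ribbon_pairing _ rib).
apply: is_ribbon_ev => X; apply: E_faithful.
have := untr_tw (ld R X); rewrite (proj2 (tw_central _) (cE _)) untr_wl => H.
have er : epi (asc E (ld R X) X) by apply: epi_iso (asciK _ _ _).
have {}H := er _ _ _ (etrans (compA _ _ _) (etrans H (esym (compA _ _ _)))).
by rewrite -[LHS](k20 (ruK E)) H (k20 (ruK E)).
Qed.

End Dualizing.

Section DualCounit.
Variables (C : braided) (R : rigid C) (Q : has_coequalizers C).
Variable A : comAlgebra C.

Local Notation D := (ld R A).
Local Notation E := (DA R A).

Definition DA_counit : hom E one := ev D ∘ (D ◁ eta A) ∘ rui D.

(** Pairing [φ·a] with the unit is pairing [φ] with [a·1 = a]. *)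
Lemma DA_counit_act : DA_counit ∘ act E = ev D.
Proof.
apply: h20_inj => W.
have cW V : DA_counit ▷ V = lui V ∘ h20 (ev D) V ∘ (D ◁ h01 (eta A) V).
  rewrite /DA_counit !wr_comp wl_wr rui_wr h20E !compA !(k20 (asciK _ _ _)).
  by rewrite h01_def wl_comp.
rewrite [LHS]h20_def wr_comp cW !compA (k20 (luiK _)) -h21_def.
rewrite -(h21_nat (DA_act R A)) (k22 (DA_act_ev R A W)).
by rewrite (w20 D (hm_1r A W)) compm1.
Qed.

(** Linearity gives [ev(w(m), a) = ε(w(m·a))] with [ε] the counit, and [ev] is nondegenerate. *)
Lemma DA_counit_inj (M : rmodule A) (u v : modhom M E) :
  DA_counit ∘ u = DA_counit ∘ v -> u = v.
Proof.
move=> H; apply: modhom_eq; apply: (ev_injl (DY := D)).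
have K (w : modhom M E) : ev D ∘ (w ▷ A) = (DA_counit ∘ w) ∘ act M.
  rewrite -DA_counit_act (compA DA_counit (mh w)) (mhP w).
  exact: compA.
by rewrite !K H.
Qed.

(** Since [ev(φ, w(m)) = ε(φ·w(m))], this pairing can be read off [E ⊗_A w] through the right unitor
    and the counit [ε]; [ev] is nondegenerate in its second argument. *)
Lemma DA_ten_inj (M : rmodule A) (u v : modhom M (regA A)) :
  tenA_mor R Q (rmod_id E) u = tenA_mor R Q (rmod_id E) v -> u = v.
Proof.
move=> H; apply: modhom_eq; apply: (ev_injr (DY := D)).
have K (w : modhom M (regA A)) : ev D ∘ (D ◁ w) =
    DA_counit ∘ ruA_h R Q E ∘ mh (tenA_mor R Q (rmod_id E) w) ∘ qA Q E M.
  rewrite /= (tenA_mhE Q (rmod_id E) w) -(compA (ruA_h R Q E)) -DA_counit_act.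
  by rewrite (bdescE Q (ruA_bal E)); exact: compA.
by rewrite !K H.
Qed.

End DualCounit.

Lemma DA_pairing (C : ribbon) (Q : has_coequalizers C) (A : comAlgebra C)
    (thA : rtw C A = idm A) (X Y : loc_br (rrig C) Q A)
    (G : hom (X ⊗ Y) (DA_loc Q thA)) :
  G ∘ (loc_twist (rrig C) Q thA X ▷ Y) = G ∘ (X ◁ loc_twist (rrig C) Q thA Y).
Proof.
(* Composing with the counit and the quotient map leaves a pairing in [C]. *)
apply: DA_counit_inj; apply: epi_qA; rewrite /= !compA !tenA_mhE /=.
rewrite -!compA; apply: ribbon_pairing; exact: rribbon.
Qed.

Theorem theorem3p15 (C : ribbon) (coeq : has_coequalizers C)
    (A : comAlgebra C) (Rloc : rigid (loc_br (rrig C) coeq A))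
    (thA : rtw C A = idm A) :
  is_ribbon Rloc (loc_twist (rrig C) coeq thA) <->
  Mueger_center (DA_loc coeq thA).
Proof.
apply: ribbon_iff_Mueger.
(* The twist of [D(A)] is the transpose of that of [A], the identity. *)
- apply: modhom_eq => /=.
  by rewrite -[LHS](rribbon (r := C)) thA dualm_id.
- exact: DA_pairing.
- by move=> X u v; apply: DA_ten_inj.
Qed.
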